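(* Let $a_1,b_1,a_2,b_2,a_3,b_3$ be real numbers with $0\le a_i<b_i$ for $i=1,2,3$ and $$a_1b_2b_3+b_1a_2a_3 \;\le\; b_1a_2b_3+a_1b_2a_3 \;\le\; b_1b_2a_3+a_1a_2b_3 .$$ Let $\mathcal{P}_1\subset\mathbb{R}^4$ be the double-McCormick relaxation obtained by first grouping $x_2$ and $x_3$, let $\mathcal{P}_H\subset\mathbb{R}^4$ be the trilinear hull, and let $v^1,\dots,v^8,v_1^9,\dots,v_1^{12}\in\mathbb{R}^4$ be the points defined in the context. Then the set of extreme points of $\mathcal{P}_1$ is $\{v^1,\ldots,v^8\}\cup\{v_1^9,v_1^{10},v_1^{11},v_1^{12}\}$. Moreover, $$\operatorname{Vol}(\mathcal{P}_1)=\operatorname{Vol}(\mathcal{P}_H)+(b_1-a_1)(b_2-a_2)^2(b_3-a_3)^2\cdot\frac{3(b_1b_2a_3-a_1b_2a_3+b_1a_2b_3-a_1a_2b_3)+2(a_1b_2b_3-b_1a_2a_3)}{24(b_2b_3-a_2a_3)}.$$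
   Context: Points of $\mathbb{R}^4$ are written with coordinates $(f,x_1,x_2,x_3)$; $\operatorname{Vol}$ is 4-dimensional Lebesgue measure. Trilinear hull: $\mathcal{P}_H$ is the convex hull of the eight points $(x_1x_2x_3,x_1,x_2,x_3)$ with $x_i\in\{a_i,b_i\}$, $i=1,2,3$. Double-McCormick relaxation: $\mathcal{P}_1$ is the set of all $(f,x_1,x_2,x_3)\in\mathbb{R}^4$ for which there exists $w\in\mathbb{R}$ satisfying the McCormick inequalities for $w=x_2x_3$, $$w-a_3x_2-a_2x_3+a_2a_3\ge0,\quad -w+b_3x_2+a_2x_3-a_2b_3\ge0,\quad -w+a_3x_2+b_2x_3-b_2a_3\ge0,\quad w-b_3x_2-b_2x_3+b_2b_3\ge0,$$ and the McCormick inequalities for $f=wx_1$ with $w\in[a_2a_3,b_2b_3]$, $$f-a_1w-a_2a_3x_1+a_1a_2a_3\ge0,\quad -f+b_1w+a_2a_3x_1-b_1a_2a_3\ge0,\quad -f+a_1w+b_2b_3x_1-a_1b_2b_3\ge0,\quad f-b_1w-b_2b_3x_1+b_1b_2b_3\ge0.$$ Points: $v^1=(b_1a_2a_3,b_1,a_2,a_3)$, $v^2=(a_1a_2a_3,a_1,a_2,a_3)$, $v^3=(a_1a_2b_3,a_1,a_2,b_3)$, $v^4=(a_1b_2a_3,a_1,b_2,a_3)$, $v^5=(a_1b_2b_3,a_1,b_2,b_3)$, $v^6=(b_1b_2b_3,b_1,b_2,b_3)$, $v^7=(b_1b_2a_3,b_1,b_2,a_3)$, $v^8=(b_1a_2b_3,b_1,a_2,b_3)$,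 and $$v_1^9=(\theta^1,\theta^2,a_2,b_3),\quad v_1^{10}=(\theta^3,\theta^4,b_2,a_3),\quad v_1^{11}=(\theta^5,\theta^6,b_2,a_3),\quad v_1^{12}=(\theta^7,\theta^8,a_2,b_3),$$ where, with $D=b_2b_3-a_2a_3$, $$\theta^1=a_1a_2a_3+\tfrac{a_2(b_3-a_3)(b_1b_2b_3-a_1a_2a_3)}{D},\quad \theta^2=a_1+\tfrac{a_2(b_1-a_1)(b_3-a_3)}{D},$$ $$\theta^3=a_1a_2a_3+\tfrac{a_3(b_2-a_2)(b_1b_2b_3-a_1a_2a_3)}{D},\quad \theta^4=a_1+\tfrac{a_3(b_2-a_2)(b_1-a_1)}{D},$$ $$\theta^5=\tfrac{b_2a_3(a_1b_2b_3-a_1a_2b_3-b_1a_2a_3+b_1a_2b_3)}{D},\quad \theta^6=a_1+\tfrac{b_2(b_1-a_1)(b_3-a_3)}{D},$$ $$\theta^7=\tfrac{a_2b_3(b_1b_2a_3-b_1a_2a_3-a_1b_2a_3+a_1b_2b_3)}{D},\quad \theta^8=a_1+\tfrac{b_3(b_2-a_2)(b_1-a_1)}{D}.$$ (When some $a_i=0$ some of the listed points may coincide; the statement concerns the set of points.) *)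

(* Defs.v *)
From mathcomp Require Import all_boot all_order all_algebra.
From mathcomp Require Import all_classical all_reals all_analysis.

Set Implicit Arguments.
Unset Strict Implicit.
Unset Printing Implicit Defensive.

Import Order.TTheory GRing.Theory Num.Theory.
Import numFieldNormedType.Exports.

Local Open Scope classical_set_scope.
Local Open Scope ring_scope.

(* A point of R^4 is (f, x1, x2, x3) = (((f, x1), x2), x3). *)
Notation R4 R := (R * R * R * R)%type (only parsing).

Definition vol4 (R : realType) (A : set (R4 R)) : \bar R :=
  (lebesgue_measure \x lebesgue_measure \x lebesgue_measure
    \x lebesgue_measure)%E A.

Definition conv_hull (R : numDomainType) (E : lmodType R) (A : set E) : set E :=
  smallest (@convex_set R E) A.

Definition extreme_points (R : numDomainType) (E : lmodType R) (A : set E) :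
    set E :=
  [set x | A x /\ forall (y z : E) (t : R), A y -> A z -> 0 < t -> t < 1 ->
    x = t *: y + (1 - t) *: z -> y = z].

Section Trilinear.
Context {R : realType}.
Variables a1 b1 a2 b2 a3 b3 : R.

Definition trilinear_hull : set (R4 R) :=
  conv_hull [set p | exists x1 x2 x3 : R,
    [/\ x1 = a1 \/ x1 = b1, x2 = a2 \/ x2 = b2, x3 = a3 \/ x3 = b3
      & p = (x1 * x2 * x3, x1, x2, x3)]].

(* Relaxes w = x2 * x3 over x2 in [a2, b2], x3 in [a3, b3]. *)
Definition mccormick_w (w x2 x3 : R) : Prop :=
  [/\ 0 <= w - a3 * x2 - a2 * x3 + a2 * a3,
      0 <= - w + b3 * x2 + a2 * x3 - a2 * b3,
      0 <= - w + a3 * x2 + b2 * x3 - b2 * a3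
    & 0 <= w - b3 * x2 - b2 * x3 + b2 * b3].

(* Relaxes f = w * x1 over w in [a2 * a3, b2 * b3], x1 in [a1, b1]. *)
Definition mccormick_f (f w x1 : R) : Prop :=
  [/\ 0 <= f - a1 * w - a2 * a3 * x1 + a1 * a2 * a3,
      0 <= - f + b1 * w + a2 * a3 * x1 - b1 * a2 * a3,
      0 <= - f + a1 * w + b2 * b3 * x1 - a1 * b2 * b3
    & 0 <= f - b1 * w - b2 * b3 * x1 + b1 * b2 * b3].

Definition double_mccormick : set (R4 R) :=
  [set p | let: (f, x1, x2, x3) := p in
    exists w : R, mccormick_w w x2 x3 /\ mccormick_f f w x1].

Definition v1 : R4 R := (b1 * a2 * a3, b1, a2, a3).
Definition v2 : R4 R := (a1 * a2 * a3, a1, a2, a3).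
Definition v3 : R4 R := (a1 * a2 * b3, a1, a2, b3).
Definition v4 : R4 R := (a1 * b2 * a3, a1, b2, a3).
Definition v5 : R4 R := (a1 * b2 * b3, a1, b2, b3).
Definition v6 : R4 R := (b1 * b2 * b3, b1, b2, b3).
Definition v7 : R4 R := (b1 * b2 * a3, b1, b2, a3).
Definition v8 : R4 R := (b1 * a2 * b3, b1, a2, b3).

Local Notation D := (b2 * b3 - a2 * a3).

Definition theta1 : R :=
  a1 * a2 * a3 + a2 * (b3 - a3) * (b1 * b2 * b3 - a1 * a2 * a3) / D.
Definition theta2 : R := a1 + a2 * (b1 - a1) * (b3 - a3) / D.
Definition theta3 : R :=
  a1 * a2 * a3 + a3 * (b2 - a2) * (b1 * b2 * b3 - a1 * a2 * a3) / D.
Definition theta4 : R := a1 + a3 * (b2 - a2) * (b1 - a1) / D.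
Definition theta5 : R :=
  b2 * a3 * (a1 * b2 * b3 - a1 * a2 * b3 - b1 * a2 * a3 + b1 * a2 * b3) / D.
Definition theta6 : R := a1 + b2 * (b1 - a1) * (b3 - a3) / D.
Definition theta7 : R :=
  a2 * b3 * (b1 * b2 * a3 - b1 * a2 * a3 - a1 * b2 * a3 + a1 * b2 * b3) / D.
Definition theta8 : R := a1 + b3 * (b2 - a2) * (b1 - a1) / D.

Definition v9 : R4 R := (theta1, theta2, a2, b3).
Definition v10 : R4 R := (theta3, theta4, b2, a3).
Definition v11 : R4 R := (theta5, theta6, b2, a3).
Definition v12 : R4 R := (theta7, theta8, a2, b3).

End Trilinear.

(* Main.v *)
(* Over the box, both bodies are regions between two explicit piecewise linear
   functions of the normalized coordinates r, s, t in [0, 1] of x1, x2, x3.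

   Since a1 >= 0, every McCormick bound on f is nondecreasing in w, so P_1 is
   cut out by the lower bounds at the least admissible w and the upper bounds
   at the greatest.  For P_H, write x1 x2 x3 as an affine function plus
   A1 st + A2 rt + A3 rs + E rst with A1 = a1 d2 d3, A2 = a2 d1 d3,
   A3 = a3 d1 d2, E = d1 d2 d3 and d_i = b_i - a_i.  The concave envelope
   replaces each product by a minimum.  The hypothesis gives A1 <= A2, A3, and
   then the convex envelope is the same affine function plus
     A1 ((r+s+t-1)^+ + (r+s+t-2)^+) + (A2 - A1) (r+t-1)^+
       + (A3 - A1) (r+s-1)^+ + E (r+s+t-2)^+.
   Both volumes then reduce to iterated integrals of splines.

   For the extreme points, P_1 is the image of a multiaffine map, from the
   barycentric coordinates of (w, x2, x3) in its tetrahedron and two parameters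
   y0, y1 in [a1, b1] locating (f, x1) on the edges w = a2 a3 and w = b2 b3 of
   the second tetrahedron.  So an extreme point is the image of a vertex of the
   parameter domain, and conversely each such image is the only point of P_1
   on four of its supporting hyperplanes. *)

From HB Require Import structures.
Require Import Defs.
From mathcomp Require Import all_boot all_order all_algebra.
From mathcomp Require Import all_classical all_reals all_analysis.
From mathcomp Require Import measurable_realfun.
From mathcomp Require Import ring lra.

Set Implicit Arguments.
Unset Strict Implicit.
Unset Printing Implicit Defensive.

Import Order.TTheory GRing.Theory Num.Theory.
Import numFieldNormedType.Exports.

Local Open Scope classical_set_scope.
Local Open Scope ring_scope.

(** * Iterated volumes *)

(** Exhaust by the rectangles [F n] times [G n]: both sequences are nondecreasing, so a pair caught
    at indices n and k is caught at their maximum. *)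
Lemma product_measure_sigma_finite (R : realType) d1 d2
    (T1 : measurableType d1) (T2 : measurableType d2)
    (m1 : {sigma_finite_measure set T1 -> \bar R})
    (m2 : {sigma_finite_measure set T2 -> \bar R}) :
  sigma_finite setT (m1 \x m2)%E.
Proof.
have /sigma_finiteP[F [TF ndF Foo]] := sigma_finiteT m1.
have /sigma_finiteP[G [TG ndG Goo]] := sigma_finiteT m2.
exists (fun n => F n `*` G n) => [|n].
  rewrite -setXTT TF TG; apply/seteqP; split=> [[x y] /=|[x y] [n _ []]].
    move=> [[n _ Fnx] [k _ Gky]]; exists (maxn n k) => //; split.
      exact: (subsetPset _ _ (ndF _ _ (leq_maxl n k))).
    exact: (subsetPset _ _ (ndG _ _ (leq_maxr n k))).
  by split; exists n.
have [mF Fy] := Foo n; have [mG Gy] := Goo n.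
split; first exact: measurableX.
by rewrite product_measure1E// lte_mul_pinfty// ge0_fin_numE.
Qed.

Section IteratedVolume.
Context {R : realType}.
Local Notation mu := (@lebesgue_measure R).
Local Notation T := (measurableTypeR R).

(** Both orders of integration define measures with the same values on rectangles. The exchange
    makes the last coordinate the outer variable. *)
Lemma product_measureC d1 d2 (T1 : measurableType d1) (T2 : measurableType d2)
    (m1 : {sigma_finite_measure set T1 -> \bar R})
    (m2 : {sigma_finite_measure set T2 -> \bar R}) (X : set (T1 * T2)) :
  measurable X -> (m1 \x m2)%E X = (m1 \x^ m2)%E X.
Proof.
move=> mX; apply: product_measure_unique => // A B mA mB.
exact: product_measure2E.
Qed.

Lemma vol4_iterated (A : set (T * T * T * T)) : measurable A ->
  vol4 A = (\int[mu]_x3 \int[mu]_x2 \int[mu]_x1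
    mu [set f | A (f, x1, x2, x3)])%E.
Proof.
move=> mA.
have mA3 x3 : measurable (ysection A x3) by exact: measurable_ysection.
have mA2 x3 x2 : measurable (ysection (ysection A x3) x2).
  exact: measurable_ysection.
(* Inference sees the sigma-finiteness of a product of subprobabilities only,
   hence the explicit packing. *)
pose mu2 : {sigma_finite_measure set (T * T)%type -> \bar R} :=
  HB.pack (mu \x mu)%E (Measure_isSigmaFinite.Build _ _ _ (mu \x mu)%E
    (product_measure_sigma_finite mu mu)).
pose mu3 : {sigma_finite_measure set (T * T * T)%type -> \bar R} :=
  HB.pack (mu2 \x mu)%E (Measure_isSigmaFinite.Build _ _ _ (mu2 \x mu)%E
    (product_measure_sigma_finite mu2 mu)).
have E4 : vol4 A = (mu3 \x^ mu)%E A := product_measureC mu3 mu mA.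
have E3 x3 : mu3 (ysection A x3) = (mu2 \x^ mu)%E (ysection A x3) :=
  product_measureC mu2 mu (mA3 x3).
have E2 x3 x2 : mu2 (ysection (ysection A x3) x2) =
    (mu \x^ mu)%E (ysection (ysection A x3) x2) :=
  product_measureC mu mu (mA2 x3 x2).

rewrite E4; apply: eq_integral => x3 _; rewrite [LHS]E3.
apply: eq_integral => x2 _; rewrite [LHS]E2; apply: eq_integral => x1 _.
by congr (mu _); apply/seteqP; split => f /=; rewrite !ysectionE.
Qed.

End IteratedVolume.

(** * Integrals of splines *)

Section UnitIntegral.
Context {R : realType}.
Local Notation mu := (@lebesgue_measure R).
Implicit Types (phi Phi : R -> R) (u v x y : R).

Definition pos y : R := Num.max 0 y.

Lemma posP y : (0 <= y /\ pos y = y) \/ (y <= 0 /\ pos y = 0).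
Proof.
by rewrite /pos; case: (lerP 0 y) => [y0|/ltW y0]; [left|right].
Qed.

Lemma pos_ge y : 0 <= pos y /\ y <= pos y.
Proof. by rewrite /pos !le_max !lexx orbT. Qed.

Lemma pos_id y : 0 <= y -> pos y = y. Proof. by rewrite /pos => /max_r. Qed.

Lemma pos_eq0 y : y <= 0 -> pos y = 0. Proof. by rewrite /pos => /max_l. Qed.

(** A remainder of order [h ^+ 2] forces differentiability, including at the knot of a truncated
    power, where no product rule for smooth factors applies. *)
Lemma is_derive_quadratic_error phi x l C :
  (forall h, `|phi (h + x) - phi x - h * l| <= C * h ^+ 2) ->
  is_derive x 1 phi l.
Proof.
move=> H.
have C0 : 0 <= C.
  by have := H 1; rewrite expr1n mulr1 => /(le_trans _); apply.
have cvgl : (fun h => h^-1 *: (phi (h *: 1 + x) - phi x)) @ 0^' --> l.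
  apply/cvgrPdist_le => e e0.
  near=> h.
  have h0 : h != 0 by near: h; exact: nbhs_dnbhs_neq.
  (* Dividing by C + 1 instead of C covers C = 0 and still bounds C times |h| by e. *)
  have he : `|h| <= e / (C + 1).
    near: h; apply: nbhs_dnbhs; apply: (@cvgr0_norm_le _ _ _ (nbhs (0:R)) _ id).
      exact: cvg_id.
    by rewrite divr_gt0// ltr_wpDl.
  rewrite /= [h *: 1]mulr1 distrC.
  have -> : h^-1 *: (phi (h + x) - phi x) - l =
      h^-1 * (phi (h + x) - phi x - h * l).
    by rewrite [h^-1 *: _]/(_ * _) mulrBr mulKf.
  rewrite normrM normfV ler_pdivrMl ?normr_gt0// (le_trans (H h))//.
  rewrite -[h ^+ 2]ger0_norm ?sqr_ge0// normrX expr2 mulrCA ler_wpM2l//.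
  move: he; rewrite ler_pdivlMr ?ltr_wpDl// mulrDr mulr1 [C * _]mulrC.
  by apply: le_trans; rewrite lerDl.
apply: DeriveDef; first by apply/cvg_ex; exists l.
exact/cvg_lim.
Unshelve. all: by end_near.
Qed.

(* The primitive Phi lives on all of R while phi matters on [0, 1] only, hence
   the auxiliary psi. *)
Definition is_unit_integral phi v := exists psi Phi : R -> R,
  [/\ forall x, 0 <= x <= 1 -> phi x = psi x,
      forall x, is_derive x 1 Phi (psi x), continuous psi & Phi 1 - Phi 0 = v].

Lemma is_unit_integral_eq phi psi v w : is_unit_integral psi v ->
  (forall x, 0 <= x <= 1 -> phi x = psi x) -> w = v -> is_unit_integral phi w.
Proof.
move=> [chi [Phi [psiE dPhi cchi <-]]] phiE ->; exists chi, Phi; split=> // x x01.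
by rewrite phiE// psiE.
Qed.

Lemma is_unit_integralD phi psi v w : is_unit_integral phi v ->
  is_unit_integral psi w -> is_unit_integral (fun x => phi x + psi x) (v + w).
Proof.
move=> [phi' [Phi [phiE dPhi cphi <-]]] [psi' [Psi [psiE dPsi cpsi <-]]].
exists (fun x => phi' x + psi' x), (fun x => Phi x + Psi x); split; last by ring.
- by move=> x x01; rewrite phiE// psiE.
- by move=> x; exact: is_deriveD.
- by move=> x; apply: cvgD; [exact: cphi|exact: cpsi].
Qed.

Lemma is_unit_integralZ k phi v : is_unit_integral phi v ->
  is_unit_integral (fun x => k * phi x) (k * v).
Proof.
move=> [phi' [Phi [phiE dPhi cphi <-]]].
exists (fun x => k * phi' x), (fun x => k * Phi x); split; last by ring.
- by move=> x x01; rewrite phiE.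
- by move=> x; exact: is_deriveZ.
- by move=> x; apply: cvgMr; exact: cphi.
Qed.

Lemma is_derive_continuous phi dphi :
  (forall x, is_derive x 1 phi (dphi x)) -> continuous phi.
Proof.
move=> dphiE x; apply: differentiable_continuous.
exact/derivable1_diffP/(@ex_derive _ _ _ _ _ _ _ (dphiE x)).
Qed.

Lemma is_unit_integralX n : is_unit_integral (fun x => x ^+ n) n.+1%:R^-1.
Proof.
have dX m x : is_derive x 1 (fun x : R => x ^+ m) (m%:R * x ^+ m.-1).
  have := is_deriveX m (is_derive_id x (1 : R)).
  by rewrite exprfctE [_ *: 1]mulr1.
exists (fun x => x ^+ n), (fun x => n.+1%:R^-1 * x ^+ n.+1); split=> //.
- move=> x; have := is_deriveZ (n.+1%:R^-1 : R) (dX n.+1 x).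
  by rewrite [_ *: _]mulKf// pnatr_eq0.
- exact: (is_derive_continuous (dX n)).
- by rewrite expr1n expr0n mulr0 subr0 mulr1.
Qed.

Lemma continuous_pos u : continuous (fun x => pos (x - u)).
Proof.
have -> : (fun x => pos (x - u)) = (fun x => 2^-1 * (x - u + `|x - u|)).
  apply/funext => x; have [[? ->]|[? ->]] := posP (x - u).
    by rewrite ger0_norm//; lra.
  by rewrite ler0_norm//; lra.
move=> x; have cvgB : (y - u) @[y --> x] --> x - u.
  by apply: cvgB; [exact: cvg_id|exact: cvg_cst].
by apply: cvgMr; apply: cvgD => //; exact: cvg_norm.
Qed.

Lemma is_derive_pos2 u x :
  is_derive x 1 (fun x => pos (x - u) ^+ 2) (2 * pos (x - u)).
Proof.
apply: (@is_derive_quadratic_error _ _ _ 1) => h.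
rewrite mul1r ler_norml.
(* In each of the four sign patterns the remainder lies between 0 and [h ^+ 2]. *)
by have [[? ->]|[? ->]] := posP (x - u);
  have [[? ->]|[? ->]] := posP (h + x - u); apply/andP; split; nra.
Qed.

Lemma is_derive_pos3 u x :
  is_derive x 1 (fun x => pos (x - u) ^+ 3) (3 * pos (x - u) ^+ 2).
Proof.
have posM y : y * pos y = pos y ^+ 2 by have [[_ ->]|[_ ->]] := posP y; ring.
(* Writing the cube as y times the square of its positive part reduces it to the product rule. *)
have -> : (fun x => pos (x - u) ^+ 3) =
    (fun x => x - u) * (fun x => pos (x - u) ^+ 2).
  apply/funext => y; rewrite mulrfctE.
  by have [[_ ->]|[_ ->]] := posP (y - u); ring.
have dl : is_derive x 1 (fun x => x - u) (1 - 0).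
  exact: is_deriveB.
have := is_deriveM dl (is_derive_pos2 u x).
have -> : 3 * pos (x - u) ^+ 2 =
    (x - u) * (2 * pos (x - u)) + pos (x - u) ^+ 2 * (1 - 0).
  by rewrite -posM; ring.
by [].
Qed.

Lemma is_unit_integral_pos u :
  is_unit_integral (fun x => pos (x - u)) ((pos (1 - u) ^+ 2 - pos (- u) ^+ 2) / 2).
Proof.
exists (fun x => pos (x - u)), (fun x => 2^-1 * pos (x - u) ^+ 2); split; first by [].
- move=> x; have := is_deriveZ (2^-1 : R) (is_derive_pos2 u x).
  by rewrite [_ *: _]mulKf// pnatr_eq0.
- exact: continuous_pos.
- by rewrite sub0r; ring.
Qed.

Lemma is_unit_integral_pos2 u :
  is_unit_integral (fun x => pos (x - u) ^+ 2)
    ((pos (1 - u) ^+ 3 - pos (- u) ^+ 3) / 3).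
Proof.
exists (fun x => pos (x - u) ^+ 2), (fun x => 3^-1 * pos (x - u) ^+ 3); split; first by [].
- move=> x; have := is_deriveZ (3^-1 : R) (is_derive_pos3 u x).
  by rewrite [_ *: _]mulKf// pnatr_eq0.
- exact: is_derive_continuous (is_derive_pos2 u).
- by rewrite sub0r; ring.
Qed.

(** The substitution r = (x - a) / (b - a) is absorbed into the primitive [(b - a) * Psi (z x)], so
    the fundamental theorem of calculus on [a, b] suffices. *)
Lemma integral_affine_support (g : R -> \bar R) phi v a b : a < b ->
  is_unit_integral phi v ->
  (forall r, g (a + r * (b - a)) = if 0 <= r <= 1 then (phi r)%:E else 0%E) ->
  (\int[mu]_x g x)%E = ((b - a) * v)%:E.
Proof.
move=> ab [psi [Psi [phiE dPsi cpsi <-]]] gE.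
have ba0 : 0 < b - a by rewrite subr_gt0.
pose z x := (x - a) / (b - a).
have zK x : a + z x * (b - a) = x by rewrite /z divfK ?gt_eqF// addrC subrK.
have z01 x : (0 <= z x <= 1) = (x \in `[a, b]).
  by rewrite in_itv/= /z pmulr_lge0 ?invr_gt0// subr_ge0 ler_pdivrMr// mul1r lerD2r.
have -> : g = (fun x => (psi (z x))%:E) \_ `[a, b].
  apply/funext => x; rewrite -{1}(zK x) gE z01 patchE mem_setE.
  by case: ifPn => // xab; rewrite phiE// z01.
rewrite -integral_mkcond.
have dz x : is_derive x 1 z (b - a)^-1.
  have -> : z = (fun x => (b - a)^-1 * (x - a)).
    by apply/funext => y; rewrite /z mulrC.
  have := is_deriveZ ((b - a)^-1 : R)
    (is_deriveB (is_derive_id x (1:R)) (is_derive_cst a x (1:R))).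
  by rewrite subr0 [_ *: _]mulr1.
have dF x : is_derive x 1 (fun x => (b - a) * Psi (z x)) (psi (z x)).
  have := is_deriveZ (b - a) (is_derive1_comp (dPsi (z x)) (dz x)).
  by rewrite [_ *: _]mulrC divfK// gt_eqF.
have cF := is_derive_continuous dF.
rewrite (@continuous_FTC2 _ _ (fun x => (b - a) * Psi (z x)) a b ab).
- by rewrite -EFinB -mulrBr /z subrr mul0r divff// gt_eqF.
- apply: continuous_subspaceT => x.
  apply: (@continuous_comp _ _ _ z psi); last exact: cpsi.
  exact: is_derive_continuous dz x.
- split => [x _||].
  + exact: (@ex_derive _ _ _ _ _ _ _ (dF x)).
  + exact/cvg_at_right_filter/cF.
  + exact/cvg_at_left_filter/cF.
- by move=> x _; rewrite derive1E; apply: derive_val.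
Qed.

End UnitIntegral.

(** * Volume of the region between two graphs over a box *)

Section VolumeOfRegion.
Context {R : realType}.
Local Notation mu := (@lebesgue_measure R).
Local Notation T := (measurableTypeR R).
Local Notation T4 := (T * T * T * T)%type.

(** Stated through composition with arbitrary measurable functions, so that closure rules prove it
    term by term and it applies directly to the coordinates of R^4. *)
Definition measurable3 (phi : R -> R -> R -> R) :=
  forall d (X : measurableType d) (r s t : X -> R),
  measurable_fun setT r -> measurable_fun setT s -> measurable_fun setT t ->
  measurable_fun setT (fun p => phi (r p) (s p) (t p)).

Definition region (a1 b1 a2 b2 a3 b3 : R) (lo up : R -> R -> R -> R) :
    set (R * R * R * R) :=
  [set p | let: (f, x1, x2, x3) := p in
    let r := (x1 - a1) / (b1 - a1) in
    let s := (x2 - a2) / (b2 - a2) in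
    let t := (x3 - a3) / (b3 - a3) in
    [/\ 0 <= r <= 1, 0 <= s <= 1, 0 <= t <= 1 & lo r s t <= f <= up r s t]].

Section Region.
Variables (a1 b1 a2 b2 a3 b3 : R).
Hypotheses (hab1 : a1 < b1) (hab2 : a2 < b2) (hab3 : a3 < b3).
Variables lo up : R -> R -> R -> R.
Hypotheses (mlo : measurable3 lo) (mup : measurable3 up).

Lemma measurable_region : measurable (region a1 b1 a2 b2 a3 b3 lo up : set T4).
Proof.
have mf : measurable_fun setT (fun p : T4 => p.1.1.1 : R).
  do 2! apply: (measurableT_comp measurable_fst).
  exact: measurable_fst.
have m1 : measurable_fun setT (fun p : T4 => (p.1.1.2 - a1) / (b1 - a1) : R).
  apply: measurable_funM => //; apply: measurable_funB => //.
  apply: (measurableT_comp measurable_snd).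
  by apply: (measurableT_comp measurable_fst).
have m2 : measurable_fun setT (fun p : T4 => (p.1.2 - a2) / (b2 - a2) : R).
  apply: measurable_funM => //; apply: measurable_funB => //.
  exact: (measurableT_comp measurable_snd).
have m3 : measurable_fun setT (fun p : T4 => (p.2 - a3) / (b3 - a3) : R).
  by apply: measurable_funM => //; exact: measurable_funB.
have mle (g h : T4 -> R) : measurable_fun setT g -> measurable_fun setT h ->
    measurable [set p | g p <= h p].
  by move=> mg mh; rewrite -[X in measurable X]setTI; exact: measurable_fun_le.
set r := fun p : T4 => _ in m1; set s := fun p : T4 => _ in m2.
set t := fun p : T4 => _ in m3.
have -> : region a1 b1 a2 b2 a3 b3 lo up =
  [set p | 0 <= r p] `&` [set p | r p <= 1] `&`
  ([set p | 0 <= s p] `&` [set p | s p <= 1]) `&`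
  ([set p | 0 <= t p] `&` [set p | t p <= 1]) `&`
  ([set p | lo (r p) (s p) (t p) <= p.1.1.1] `&`
   [set p | p.1.1.1 <= up (r p) (s p) (t p)]).
  apply/seteqP; split=> -[[[f x1] x2] x3] /=.
    by case=> /andP[? ?] /andP[? ?] /andP[? ?] /andP[? ?].
  by move=> [[[[? ?] [? ?]] [? ?]] [? ?]]; split; apply/andP.
by repeat (apply: measurableI); apply: mle => //; [exact: mlo|exact: mup].
Qed.

Variables (G : R -> R -> R) (H : R -> R) (v : R).
Hypothesis lo_le_up : forall r s t, 0 <= r <= 1 -> 0 <= s <= 1 -> 0 <= t <= 1 ->
  lo r s t <= up r s t.
Hypothesis int1 : forall s t, 0 <= s <= 1 -> 0 <= t <= 1 ->
  is_unit_integral (fun r => up r s t - lo r s t) (G s t).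
Hypothesis int2 : forall t, 0 <= t <= 1 -> is_unit_integral (G^~ t) (H t).
Hypothesis int3 : is_unit_integral H v.

(** The innermost measure is the length [up - lo]. Each integration in normalized coordinates then
    contributes one side length, and fibres outside the box are empty. *)
Lemma vol4_region : vol4 (region a1 b1 a2 b2 a3 b3 lo up) =
  ((b1 - a1) * (b2 - a2) * (b3 - a3) * v)%:E.
Proof.
rewrite vol4_iterated; last exact: measurable_region.
have zE (a b z : R) : a < b -> (a + z * (b - a) - a) / (b - a) = z.
  by move=> ab; rewrite addrAC subrr add0r mulfK// subr_eq0 gt_eqF.
have d0 n : (0 : \bar R) = (0 * n)%:E by rewrite mul0r.
rewrite (integral_affine_support (v := (b2 - a2) * ((b1 - a1) * v)) hab3
  (is_unit_integralZ (b2 - a2) (is_unit_integralZ (b1 - a1) int3))).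
  by congr (_%:E); ring.
move=> t; case: ifPn => [t01|tN01]; last first.
  apply: integral0_eq => x2 _; apply: integral0_eq => x1 _.
  rewrite (_ : [set _ | _] = set0) ?measure0//.
  by apply/seteqP; split=> // f; rewrite /region/= zE// => -[_ _ /(negP tN01)].
apply: (integral_affine_support hab2
  (is_unit_integralZ (b1 - a1) (int2 t01))) => s.
case: ifPn => [s01|sN01]; last first.
  apply: integral0_eq => x1 _.
  rewrite (_ : [set _ | _] = set0) ?measure0//.
  by apply/seteqP; split=> // f; rewrite /region/= zE// => -[_ /(negP sN01)].
apply: (integral_affine_support hab1 (int1 s01 t01)) => r.
case: ifPn => [r01|rN01]; last first.
  rewrite (_ : [set _ | _] = set0) ?measure0//.
  by apply/seteqP; split=> // f; rewrite /region/= zE// => -[/(negP rN01)].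
rewrite (_ : [set _ | _] = `[lo r s t, up r s t]%classic).
  rewrite lebesgue_measure_itv/= lte_fin -EFinB.
  (* The interval length formula tests a strict inequality, so the degenerate interval is treated
     separately. *)
  have := lo_le_up r01 s01 t01; rewrite le_eqVlt => /orP[/eqP ->|-> //].
  by rewrite ltxx subrr.
apply/seteqP; split=> f /=; rewrite /region/= !zE// in_itv/=.
by case.
Qed.

End Region.
End VolumeOfRegion.

(** * Integrals of cubic polynomials plus truncated powers *)

Section Splines.
Context {R : realType}.
Local Notation pos := (@pos R).

(** An entry [(p, q, u)] of the list stands for a knot at u, with coefficient p on the truncated
    linear term and q on the truncated square. The unit integrals of both bodies are instances. *)
Lemma is_unit_integral_spline (c0 c1 c2 c3 : R) (l : seq (R * R * R)) :
  is_unit_integral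
    (fun x => c0 + c1 * x + c2 * x ^+ 2 + c3 * x ^+ 3 +
      \sum_(k <- l) (k.1.1 * pos (x - k.2) + k.1.2 * pos (x - k.2) ^+ 2))
    (c0 + c1 / 2 + c2 / 3 + c3 / 4 +
      \sum_(k <- l) (k.1.1 * ((pos (1 - k.2) ^+ 2 - pos (- k.2) ^+ 2) / 2) +
                     k.1.2 * ((pos (1 - k.2) ^+ 3 - pos (- k.2) ^+ 3) / 3))).
Proof.
apply: is_unit_integralD; last first.
  elim: l => [|k l IHl].
    apply: is_unit_integral_eq (is_unit_integralZ 0 (is_unit_integralX 0)) _ _.
      by move=> x _; rewrite big_nil mul0r.
    by rewrite big_nil mul0r.
  have := is_unit_integralD (is_unit_integralD
    (is_unit_integralZ k.1.1 (is_unit_integral_pos k.2))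
    (is_unit_integralZ k.1.2 (is_unit_integral_pos2 k.2))) IHl.
  move/is_unit_integral_eq; apply => [x _|]; by rewrite big_cons.
have X n := is_unit_integralX n : is_unit_integral (fun x : R => x ^+ n) _.
have := is_unit_integralD (is_unit_integralD (is_unit_integralD
  (is_unit_integralZ c0 (X 0)) (is_unit_integralZ c1 (X 1)))
  (is_unit_integralZ c2 (X 2))) (is_unit_integralZ c3 (X 3)).
by move/is_unit_integral_eq; apply => [x _|]; rewrite ?expr0 ?expr1 ?invr1 !mulr1.
Qed.

End Splines.

(** * Envelopes of the trilinear monomial and the integral of their gap *)

Section TrilinearIntegral.
Context {R : realType}.
Local Notation pos := (@pos R).
Variables c0 c1 c2 c3 A1 A2 A3 E : R.

(* [x - pos (x - y)] is the minimum of x and y; this form makes every term a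
   truncated power of r. *)
Definition hull_upper (r s t : R) : R :=
  c0 + c1 * r + c2 * s + c3 * t + A1 * (s - pos (s - t)) +
  A2 * (r - pos (r - t)) + A3 * (r - pos (r - s)) +
  E * (r - pos (r - (s - pos (s - t)))).

Definition hull_lower (r s t : R) : R :=
  c0 + c1 * r + c2 * s + c3 * t +
  A1 * (pos (r - (1 - s - t)) + pos (r - (2 - s - t))) +
  (A2 - A1) * pos (r - (1 - t)) + (A3 - A1) * pos (r - (1 - s)) +
  E * pos (r - (2 - s - t)).

(** The gap between the envelopes integrated over r, arranged as a spline in s with knots t and 1 -
    t, ready for the next integration. *)
Definition hull_mean (s t : R) : R :=
  A2 * (t - t ^+ 2) + (A1 + A3 + E - A1 * t) * s - (A3 + E / 2) * s ^+ 2
  + (E * t - A1 - E) * pos (s - t) + E / 2 * pos (s - t) ^+ 2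
  - E / 2 * pos (s - (1 - t)) ^+ 2.

Lemma hull_int1 s t : 0 <= s <= 1 -> 0 <= t <= 1 ->
  is_unit_integral (fun r => hull_upper r s t - hull_lower r s t) (hull_mean s t).
Proof.
move=> s01 t01.
(* The affine parts cancel. The first three knots come from the upper function, the last four from
   the lower one with opposite signs. *)
have := is_unit_integral_spline (A1 * (s - pos (s - t))) (A2 + A3 + E) 0 0
  [:: (- A2, 0, t); (- A3, 0, s); (- E, 0, s - pos (s - t)); (- A1, 0, 1 - s - t);
    (- (A1 + E), 0, 2 - s - t); (A1 - A2, 0, 1 - t); (A1 - A3, 0, 1 - s)].
rewrite !big_cons !big_nil /=.
move/is_unit_integral_eq; apply => [r r01|].
  by rewrite /hull_upper /hull_lower !big_cons !big_nil /=; ring.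
move: s01 t01 => /andP[s0 s1] /andP[t0 t1].
have -> : 1 - (1 - s - t) = s + t by ring.
have -> : - (1 - s - t) = s - (1 - t) by ring.
have -> : 1 - (2 - s - t) = s - (1 - t) by ring.
rewrite /hull_mean (pos_id (y := s + t)); last lra.
rewrite (pos_id (y := 1 - t)); last lra.
rewrite (pos_id (y := 1 - s)); last lra.
rewrite (pos_eq0 (y := - t)); last lra.
rewrite (pos_eq0 (y := - s)); last lra.
rewrite (pos_eq0 (y := - (2 - s - t))); last lra.
rewrite (pos_id (y := 1 - (1 - t))); last lra.
rewrite (pos_id (y := 1 - (1 - s))); last lra.
rewrite (pos_eq0 (y := - (1 - t))); last lra.
rewrite (pos_eq0 (y := - (1 - s))); last lra.
(* Only the signs of s - t and s + t - 1 still vary over the unit square. *)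
have [[st ->]|[st ->]] := posP (s - t).
  rewrite (pos_id (y := 1 - _)); last lra.
  rewrite (pos_eq0 (y := - (s - _))); last lra.
  by have [[? ->]|[? ->]] := posP (s - (1 - t)); field.
rewrite (pos_id (y := 1 - _)); last lra.
rewrite (pos_eq0 (y := - (s - _))); last lra.
by have [[? ->]|[? ->]] := posP (s - (1 - t)); field.
Qed.

Lemma hull_int2 t : 0 <= t <= 1 -> is_unit_integral (hull_mean^~ t)
  (A3 / 6 + (A2 + A1 / 2 + E) * t - (A2 + A1 / 2 + E) * t ^+ 2 + E / 6 * t ^+ 3).
Proof.
move=> /andP[t0 t1].
have := is_unit_integral_spline (A2 * (t - t ^+ 2)) (A1 + A3 + E - A1 * t)
  (- (A3 + E / 2)) 0 [:: (E * t - A1 - E, E / 2, t); (0, - (E / 2), 1 - t)].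
rewrite !big_cons !big_nil /=.
move/is_unit_integral_eq; apply => [s _|].
  by rewrite /hull_mean !big_cons !big_nil /=; ring.
rewrite (pos_id (y := 1 - t)); last lra.
rewrite (pos_eq0 (y := - t)); last lra.
rewrite (pos_id (y := 1 - (1 - t))); last lra.
rewrite (pos_eq0 (y := - (1 - t))); last lra.
by field.
Qed.

Lemma hull_int3 : is_unit_integral
  (fun t => A3 / 6 + (A2 + A1 / 2 + E) * t - (A2 + A1 / 2 + E) * t ^+ 2 +
    E / 6 * t ^+ 3)
  (A1 / 12 + A2 / 6 + A3 / 6 + 5 * E / 24).
Proof.
have := is_unit_integral_spline (A3 / 6) (A2 + A1 / 2 + E)
  (- (A2 + A1 / 2 + E)) (E / 6) [::].
rewrite big_nil.
by move/is_unit_integral_eq; apply => [t _|]; rewrite ?big_nil; field.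
Qed.

(** Regrouped by A1, A2, A3 and E, the gap is a combination with nonnegative coefficients of four
    brackets, each nonnegative on the unit cube. *)
Lemma hull_lower_le_upper r s t : 0 <= A1 -> A1 <= A2 -> A1 <= A3 -> 0 <= E ->
  0 <= r <= 1 -> 0 <= s <= 1 -> 0 <= t <= 1 ->
  hull_lower r s t <= hull_upper r s t.
Proof.
move=> A10 A12 A13 E0 /andP[r0 r1] /andP[s0 s1] /andP[t0 t1].
have A20 := le_trans A10 A12; have A30 := le_trans A10 A13.
rewrite -subr_ge0.
have -> : hull_upper r s t - hull_lower r s t =
  A1 * (s - pos (s - t) - pos (r - (1 - s - t)) - pos (r - (2 - s - t)) +
    pos (r - (1 - t)) + pos (r - (1 - s))) +
  A2 * (r - pos (r - t) - pos (r - (1 - t))) +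
  A3 * (r - pos (r - s) - pos (r - (1 - s))) +
  E * (r - pos (r - (s - pos (s - t))) - pos (r - (2 - s - t))).
  by rewrite /hull_upper /hull_lower; ring.
rewrite !addr_ge0// mulr_ge0//; clear -r0 r1 s0 s1 t0 t1.
- have [? ?] := pos_ge (r - (1 - t)); have [? ?] := pos_ge (r - (1 - s)).
  have [[? ->]|[? ->]] := posP (s - t);
  have [[? ->]|[? ->]] := posP (r - (1 - s - t));
  have [[? ->]|[? ->]] := posP (r - (2 - s - t)); lra.
- by have [[? ->]|[? ->]] := posP (r - (1 - t));
    have [[? ->]|[? ->]] := posP (r - t); lra.
- by have [[? ->]|[? ->]] := posP (r - (1 - s));
    have [[? ->]|[? ->]] := posP (r - s); lra.
- have [[? ->]|[? ->]] := posP (r - (2 - s - t));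
  have [[? ->]|[? ->]] := posP (s - t);
  set m := (X in pos (r - X)); have := posP (r - m);
  rewrite /m => -[[? ->]|[? ->]]; lra.
Qed.

End TrilinearIntegral.

(** * Bounds of the double-McCormick relaxation and the integral of their gap *)

Section DoubleMcCormickIntegral.
Context {R : realType}.
Local Notation pos := (@pos R).
Variables c0 c1 a d al be de : R.
Local Notation D := (al + be + de).
Hypotheses (al0 : 0 <= al) (be0 : 0 <= be) (de0 : 0 < de).

Let D0 : 0 < D. Proof. by rewrite ltr_wpDl// addr_ge0. Qed.

(* The greatest and least values of (w - a2 a3) / D over (s, t), for
   al = a3 d2, be = a2 d3, de = d2 d3 and D = b2 b3 - a2 a3 = al + be + de. *)
Definition wmax (s t : R) : R := (al * s + be * t + de * (s - pos (s - t))) / D.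
Definition wmin (s t : R) : R := (al * s + be * t + de * pos (s - (1 - t))) / D.

(** With h the normalized w, the product w x1 is affine in r and h plus d D r h. McCormick replaces
    r h by min(r, h) above and by the positive part of r + h - 1 below; here a and d stand for a1
    and b1 - a1. *)
Definition dmc_upper (r s t : R) : R :=
  c0 + c1 * r + a * D * wmax s t + d * D * (r - pos (r - wmax s t)).

Definition dmc_lower (r s t : R) : R :=
  c0 + c1 * r + a * D * wmin s t + d * D * pos (r - (1 - wmin s t)).

Lemma wmin_ge0 s t : 0 <= s <= 1 -> 0 <= t <= 1 -> 0 <= wmin s t.
Proof.
move=> /andP[s0 s1] /andP[t0 t1]; rewrite divr_ge0 ?(ltW D0)//.
by rewrite !addr_ge0 ?mulr_ge0// ?(ltW de0)// le_max lexx.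
Qed.

Lemma wmax_le1 s t : 0 <= s <= 1 -> 0 <= t <= 1 -> wmax s t <= 1.
Proof.
move=> /andP[s0 s1] /andP[t0 t1]; rewrite ler_pdivrMr// mul1r.
have m1 : s - pos (s - t) <= 1 by have [? ?] := pos_ge (s - t); lra.
by rewrite !lerD// ler_piMr// ltW.
Qed.

Lemma wmin_le_wmax s t : 0 <= s <= 1 -> 0 <= t <= 1 -> wmin s t <= wmax s t.
Proof.
move=> /andP[s0 s1] /andP[t0 t1]; rewrite ler_pM2r ?invr_gt0// lerD2l ler_pM2l//.
by have [[? ->]|[? ->]] := posP (s - t);
  have [[? ->]|[? ->]] := posP (s - (1 - t)); lra.
Qed.

(** Beyond [wmin <= wmax], this needs the positive part of r + wmin - 1 to be at most min(r, wmax),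
    which holds because all three quantities lie in [0, 1]. *)
Lemma dmc_lower_le_upper r s t : 0 <= a -> 0 <= d ->
  0 <= r <= 1 -> 0 <= s <= 1 -> 0 <= t <= 1 -> dmc_lower r s t <= dmc_upper r s t.
Proof.
move=> a0 d0 /andP[r0 r1] s01 t01; have h0 := wmin_ge0 s01 t01.
have h1 := wmax_le1 s01 t01; have hh := wmin_le_wmax s01 t01.
rewrite /dmc_lower /dmc_upper; apply: lerD.
  by rewrite lerD2l ler_wpM2l// mulr_ge0// ltW.
rewrite ler_wpM2l ?mulr_ge0 ?(ltW D0)//.
have [[? ->]|[? ->]] := posP (r - (1 - wmin s t));
  have [[? ->]|[? ->]] := posP (r - wmax s t); lra.
Qed.

(** Over r in [0, 1], min(r, h) integrates to h - h^2 / 2 and the positive part of r + h - 1 to h^2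
    / 2. *)
Definition dmc_mean (s t : R) : R :=
  a * D * (wmax s t - wmin s t) +
  d * D * (wmax s t - wmax s t ^+ 2 / 2 - wmin s t ^+ 2 / 2).

Lemma dmc_int1 s t : 0 <= s <= 1 -> 0 <= t <= 1 ->
  is_unit_integral (fun r => dmc_upper r s t - dmc_lower r s t) (dmc_mean s t).
Proof.
move=> s01 t01; have h0 := wmin_ge0 s01 t01.
have h1 := wmax_le1 s01 t01; have hh := wmin_le_wmax s01 t01.
have := is_unit_integral_spline (a * D * (wmax s t - wmin s t)) (d * D) 0 0
  [:: (- (d * D), 0, wmax s t); (- (d * D), 0, 1 - wmin s t)].
rewrite !big_cons !big_nil /=.
move/is_unit_integral_eq; apply => [r _|].
  by rewrite /dmc_upper /dmc_lower !big_cons !big_nil /=; ring.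
rewrite (pos_id (y := 1 - wmax s t)); last lra.
rewrite (pos_eq0 (y := - wmax s t)); last lra.
rewrite (pos_id (y := 1 - (1 - wmin s t))); last lra.
rewrite (pos_eq0 (y := - (1 - wmin s t))); last lra.
by rewrite /dmc_mean; field.
Qed.

Definition dmc_marginal (t : R) : R :=
  (d * al / 2 - d * al ^+ 2 / (3 * D)) +
  (a * de + d * (be + 3 * de / 2) -
    d / (2 * D) * (2 * al * be + de * be + 2 * de * al + de ^+ 2)) * t +
  (- a * de - d * 3 * de / 2 - d / (2 * D) * (2 * be ^+ 2 - de * al - de ^+ 2))
    * t ^+ 2 +
  (d * de / 2 - d / (2 * D) * (de * al / 3 + 2 * de ^+ 2 / 3 + de * be)) * t ^+ 3.

Lemma dmc_int2 t : 0 <= t <= 1 -> is_unit_integral (dmc_mean^~ t) (dmc_marginal t).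
Proof.
move=> /andP[t0 t1].
have DN0 : al + be + de != 0 by rewrite gt_eqF.
(* The squares of [wmax] and [wmin] produce products of s with a truncated term. Writing s = (s - u)
   + u at the knot u turns them into truncated squares and linear terms. *)
have := is_unit_integral_spline (d * be * t - d / D * be ^+ 2 * t ^+ 2)
  (a * de + d * (al + de) - d / D * (2 * al * be + de * be) * t)
  (- d / (2 * D) * (2 * al ^+ 2 + 2 * de * al + de ^+ 2)) 0
  [:: (- a * de - d * de + d * de * t, d / (2 * D) * (2 * de * al + de ^+ 2), t);
    (- a * de - d / D * de * (al * (1 - t) + be * t),
     - (d / (2 * D) * (2 * de * al + de ^+ 2)), 1 - t)].
rewrite !big_cons !big_nil /=.
move/is_unit_integral_eq; apply => [s _|].
  rewrite /dmc_mean /wmax /wmin !big_cons !big_nil /=.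
  by have [[? ->]|[? ->]] := posP (s - t);
    have [[? ->]|[? ->]] := posP (s - (1 - t)); field.
rewrite (pos_id (y := 1 - t)); last lra.
rewrite (pos_eq0 (y := - t)); last lra.
rewrite (pos_id (y := 1 - (1 - t))); last lra.
rewrite (pos_eq0 (y := - (1 - t))); last lra.
by rewrite /dmc_marginal; field.
Qed.

Lemma dmc_int3 : is_unit_integral dmc_marginal
  (a * de / 6 + d * ((al + be) / 2 + 3 * de / 8) -
   d / (2 * D) * (2 * al ^+ 2 / 3 + 2 * be ^+ 2 / 3 + al * be +
     3 * de * (al + be) / 4 + de ^+ 2 / 3)).
Proof.
have DN0 : al + be + de != 0 by rewrite gt_eqF.
apply: is_unit_integral_eq (is_unit_integral_spline _ _ _ _ [::]) _ _ => [t _|].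
  by rewrite big_nil addr0; reflexivity.
by rewrite big_nil; field.
Qed.

End DoubleMcCormickIntegral.

(** * Measurability of the four bounding functions *)

Section Measurability.
Context {R : realType}.
Local Notation pos := (@pos R).

Lemma measurable_pos d (T : measurableType d) (f : T -> R) :
  measurable_fun setT f -> measurable_fun setT (fun x => pos (f x)).
Proof. by move=> mf; exact: measurable_maxr. Qed.

Ltac measurability := repeat first
  [ assumption | exact: measurable_cst | apply: measurable_pos
  | apply: measurable_funB | apply: measurable_funN | apply: measurable_funD
  | apply: measurable_funM ].

Lemma measurable_hull_upper (c0 c1 c2 c3 A1 A2 A3 E : R) :
  measurable3 (hull_upper c0 c1 c2 c3 A1 A2 A3 E).
Proof. by move=> X dX r s t mr ms mt; rewrite /hull_upper; measurability. Qed.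

Lemma measurable_hull_lower (c0 c1 c2 c3 A1 A2 A3 E : R) :
  measurable3 (hull_lower c0 c1 c2 c3 A1 A2 A3 E).
Proof. by move=> X dX r s t mr ms mt; rewrite /hull_lower; measurability. Qed.

Lemma measurable_dmc_upper (c0 c1 a d al be de : R) :
  measurable3 (dmc_upper c0 c1 a d al be de).
Proof. by move=> X dX r s t mr ms mt; rewrite /dmc_upper /wmax; measurability. Qed.

Lemma measurable_dmc_lower (c0 c1 a d al be de : R) :
  measurable3 (dmc_lower c0 c1 a d al be de).
Proof. by move=> X dX r s t mr ms mt; rewrite /dmc_lower /wmin; measurability. Qed.

End Measurability.

(** * The double-McCormick relaxation as a region *)

Section DoubleMcCormickRegion.
Context {R : realType}.
Variables a1 b1 a2 b2 a3 b3 : R.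
Hypotheses (a1_ge0 : 0 <= a1) (a2_ge0 : 0 <= a2) (a3_ge0 : 0 <= a3).
Hypotheses (hab1 : a1 < b1) (hab2 : a2 < b2) (hab3 : a3 < b3).
Local Notation d1 := (b1 - a1).
Local Notation d2 := (b2 - a2).
Local Notation d3 := (b3 - a3).

(** Each inequality is jointly affine, so its two instances combine with weights t and 1 - t. *)
Lemma mccormick_w_conv (w x2 x3 w' x2' x3' t : R) : 0 <= t -> t <= 1 ->
  mccormick_w a2 b2 a3 b3 w x2 x3 -> mccormick_w a2 b2 a3 b3 w' x2' x3' ->
  mccormick_w a2 b2 a3 b3 (t * w + (1 - t) * w') (t * x2 + (1 - t) * x2')
    (t * x3 + (1 - t) * x3').
Proof.
move=> t0 t1; have t1' : 0 <= 1 - t by rewrite subr_ge0.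
by move=> [H1 H2 H3 H4] [K1 K2 K3 K4]; split;
  [move: H1 K1|move: H2 K2|move: H3 K3|move: H4 K4];
  move=> /(mulr_ge0 t0) H /(mulr_ge0 t1') K; have := addr_ge0 H K;
  apply: etrans; congr (_ <= _); ring.
Qed.

Lemma mccormick_f_conv (f w x1 f' w' x1' t : R) : 0 <= t -> t <= 1 ->
  mccormick_f a1 b1 a2 b2 a3 b3 f w x1 -> mccormick_f a1 b1 a2 b2 a3 b3 f' w' x1' ->
  mccormick_f a1 b1 a2 b2 a3 b3 (t * f + (1 - t) * f') (t * w + (1 - t) * w')
    (t * x1 + (1 - t) * x1').
Proof.
move=> t0 t1; have t1' : 0 <= 1 - t by rewrite subr_ge0.
by move=> [H1 H2 H3 H4] [K1 K2 K3 K4]; split;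
  [move: H1 K1|move: H2 K2|move: H3 K3|move: H4 K4];
  move=> /(mulr_ge0 t0) H /(mulr_ge0 t1') K; have := addr_ge0 H K;
  apply: etrans; congr (_ <= _); ring.
Qed.

Local Notation c0 := (a1 * a2 * a3).
Local Notation c1 := (a2 * a3 * d1).
Local Notation al := (a3 * d2).
Local Notation be := (a2 * d3).
Local Notation de := (d2 * d3).
Local Notation D := (al + be + de).

Let d1_gt0 : 0 < d1. Proof. by rewrite subr_gt0. Qed.
Let d2_gt0 : 0 < d2. Proof. by rewrite subr_gt0. Qed.
Let d3_gt0 : 0 < d3. Proof. by rewrite subr_gt0. Qed.
Let al_ge0 : 0 <= al. Proof. by rewrite mulr_ge0// ltW. Qed.
Let be_ge0 : 0 <= be. Proof. by rewrite mulr_ge0// ltW. Qed.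
Let de_gt0 : 0 < de. Proof. by rewrite mulr_gt0. Qed.
Let D_gt0 : 0 < D. Proof. by rewrite ltr_wpDl// addr_ge0. Qed.

Lemma mccormick_w_affine (k s t : R) :
  mccormick_w a2 b2 a3 b3 (a2 * a3 + k) (a2 + s * d2) (a3 + t * d3) <->
  [/\ 0 <= s <= 1, 0 <= t <= 1 &
      D * wmin al be de s t <= k <= D * wmax al be de s t].
Proof.
rewrite /wmin /wmax ![D * (_ / D)]mulrC !divfK ?gt_eqF//.
set q := al * s + be * t.
have -> : mccormick_w a2 b2 a3 b3 (a2 * a3 + k) (a2 + s * d2) (a3 + t * d3) <->
    [/\ 0 <= k - q, 0 <= q - k + de * s, 0 <= q - k + de * t &
        0 <= k - q - de * (s + t - 1)].
  by rewrite /q; split=> -[H1 H2 H3 H4]; split;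
    [move: H1|move: H2|move: H3|move: H4|move: H1|move: H2|move: H3|move: H4];
    apply: etrans; congr (_ <= _); ring.
split.
  move=> [H1 H2 H3 H4].
  (* Adding two of the four inequalities cancels k and leaves [de] times a slack of the unit
     square. *)
  have s0 : 0 <= s by rewrite -(pmulr_rge0 _ de_gt0); lra.
  have t0 : 0 <= t by rewrite -(pmulr_rge0 _ de_gt0); lra.
  have s1 : 0 <= 1 - s by rewrite -(pmulr_rge0 _ de_gt0); lra.
  have t1 : 0 <= 1 - t by rewrite -(pmulr_rge0 _ de_gt0); lra.
  split; [lra|lra|].
  by have [[? ->]|[? ->]] := posP (s - t);
     have [[? ->]|[? ->]] := posP (s - (1 - t)); lra.
move=> [/andP[s0 s1] /andP[t0 t1] /andP[]].
rewrite -subr_ge0 => H1; rewrite -subr_ge0 => H2.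
have [p0 ps] := pos_ge (s - t); have [n0 ns] := pos_ge (s - (1 - t)).
have := mulr_ge0 (ltW de_gt0) p0; have := mulr_ge0 (ltW de_gt0) n0.
move: ps; rewrite -subr_ge0 => /(mulr_ge0 (ltW de_gt0)) ps.
move: ns; rewrite -subr_ge0 => /(mulr_ge0 (ltW de_gt0)) ns.
by move=> *; split; lra.
Qed.

Lemma mccormick_f_affine (f k r : R) :
  mccormick_f a1 b1 a2 b2 a3 b3 f (a2 * a3 + k) (a1 + r * d1) <->
  [/\ 0 <= f - c0 - c1 * r - a1 * k,
      0 <= c0 + c1 * r + a1 * k + d1 * k - f,
      0 <= c0 + c1 * r + a1 * k + d1 * D * r - f &
      0 <= f - c0 - c1 * r - a1 * k - d1 * (k + D * r - D)].
Proof.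
by split=> -[H1 H2 H3 H4]; split;
  [move: H1|move: H2|move: H3|move: H4|move: H1|move: H2|move: H3|move: H4];
  apply: etrans; congr (_ <= _); ring.
Qed.

Lemma double_mccormick_affine (f r s t : R) :
  double_mccormick a1 b1 a2 b2 a3 b3 (f, a1 + r * d1, a2 + s * d2, a3 + t * d3) <->
  [/\ 0 <= r <= 1, 0 <= s <= 1, 0 <= t <= 1 &
      dmc_lower c0 c1 a1 d1 al be de r s t <= f <=
      dmc_upper c0 c1 a1 d1 al be de r s t].
Proof.
split.
  move=> [w]; have -> : w = a2 * a3 + (w - a2 * a3) by ring.
  set k := w - a2 * a3; move=> [/mccormick_w_affine[s01 t01 /andP[k0 k1]]].
  move=> /mccormick_f_affine[H1 H2 H3 H4].
  have h0 : 0 <= D * wmin al be de s t by rewrite (mulr_ge0 (ltW D_gt0))// wmin_ge0.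
  have h1 : D * wmax al be de s t <= D.
    by rewrite -[leRHS]mulr1 ler_pM2l// wmax_le1.
  (* The first and third bounds on f add up to d1 D r, the second and fourth to d1 D (1 - r). *)
  have r0 : 0 <= r.
    by rewrite -(pmulr_rge0 _ (mulr_gt0 d1_gt0 D_gt0)); lra.
  have r1 : 0 <= 1 - r.
    by rewrite -(pmulr_rge0 _ (mulr_gt0 d1_gt0 D_gt0)); lra.
  split=> //; first lra.
  rewrite /dmc_lower /dmc_upper.
  move: k0 k1; rewrite -![_ <= _ * _]subr_ge0 -![_ * _ <= _]subr_ge0 => k0 k1.
  (* The bounds on f grow with k at rates built from a1 and d1. Multiplying the slacks of k by these
     rates moves each bound to the extreme value of k. *)
  have ak0 := mulr_ge0 a1_ge0 k0; have ak1 := mulr_ge0 a1_ge0 k1.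
  have dk0 := mulr_ge0 (ltW d1_gt0) k0; have dk1 := mulr_ge0 (ltW d1_gt0) k1.
  move: H1 H2 H3 H4 {k0 k1} ak0 ak1 {h0 h1 r0 r1} dk0 dk1.
  move: (wmin al be de s t) (wmax al be de s t) (D) (c0) (c1 * r) => m M D' C X.
  by move: (d1) => d *; have [[_ ->]|[_ ->]] := posP (r - M);
    have [[_ ->]|[_ ->]] := posP (r - (1 - m)); apply/andP; split; lra.
move=> [r01 s01 t01 /andP[fl fu]].
set kmin := D * wmin al be de s t; set kmax := D * wmax al be de s t.
have kk : kmin <= kmax by rewrite ler_pM2l// wmin_le_wmax.
have kmin0 : 0 <= kmin by rewrite (mulr_ge0 (ltW D_gt0))// wmin_ge0.
have kmaxD : kmax <= D by rewrite -[leRHS]mulr1 ler_pM2l// wmax_le1.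
move: r01 => /andP[r0 r1].
have Dr0 : 0 <= D * r by rewrite mulr_ge0// ltW.
have Dr1 : D * r <= D by rewrite -[leRHS]mulr1 ler_pM2l.
(* The range allowed for f at a fixed k: [glo] and [gup] merge the two lower and the two upper
   McCormick bounds. *)
pose glo k := c0 + c1 * r + a1 * k + d1 * pos (k + D * r - D).
pose gup k := c0 + c1 * r + a1 * k + d1 * (k - pos (k - D * r)).
have fP k g : glo k <= g <= gup k ->
    mccormick_f a1 b1 a2 b2 a3 b3 g (a2 * a3 + k) (a1 + r * d1).
  move=> /andP[]; rewrite -subr_ge0 => gl; rewrite -subr_ge0 => gu.
  have [p0 ps] := pos_ge (k + D * r - D); have [n0 ns] := pos_ge (k - D * r).
  move: ps ns; rewrite -subr_ge0 -[k - D * r <= _]subr_ge0 => ps ns.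
  have := mulr_ge0 (ltW d1_gt0) p0; have := mulr_ge0 (ltW d1_gt0) n0.
  have := mulr_ge0 (ltW d1_gt0) ps; have := mulr_ge0 (ltW d1_gt0) ns.
  move: gl gu; rewrite /glo /gup => ? ? ? ? ? ?; apply/mccormick_f_affine.
  by split; lra.
have posM y : D * pos y = pos (D * y).
  by rewrite /pos maxr_pMr ?mulr0// ltW.
have glE : dmc_lower c0 c1 a1 d1 al be de r s t = glo kmin.
  rewrite /dmc_lower /glo -!mulrA; congr (_ + _ * _).
  by apply: (etrans (posM _)); congr pos; rewrite /kmin; ring.
have guE : dmc_upper c0 c1 a1 d1 al be de r s t = gup kmax.
  rewrite /dmc_upper /gup -!mulrA; congr (_ + _ * _).
  rewrite mulrBr; apply: (etrans (congr1 (fun y => _ - y) (posM _))).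
  have -> : D * (r - wmax al be de s t) = D * r - kmax by rewrite /kmax; ring.
  (* Both sides are min(x, y), written from either argument. *)
  move: (D * r) (kmax) => x y.
  by have [[? ->]|[? ->]] := posP (x - y); have [[? ->]|[? ->]] := posP (y - x); lra.
have glu k : 0 <= k <= D -> glo k <= gup k.
  move=> /andP[k0 k1]; rewrite lerD2l ler_pM2l//.
  by have [[? ->]|[? ->]] := posP (k + D * r - D);
    have [[? ->]|[? ->]] := posP (k - D * r); lra.
suff [k [kk01 Hk]] : exists k, kmin <= k <= kmax /\
    mccormick_f a1 b1 a2 b2 a3 b3 f (a2 * a3 + k) (a1 + r * d1).
  exists (a2 * a3 + k); split=> //; exact/mccormick_w_affine.
(* The fibre over r is convex in (w, f): when f misses its sections at both ends
   of the range of w, interpolate between the nearest points of these sections. *)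
move: fl fu; rewrite glE guE => fl fu.
have [f1|f1] := leP f (gup kmin).
  by exists kmin; rewrite lexx kk; split=> //; apply: fP; rewrite fl f1.
have [f2|f2] := leP (glo kmax) f.
  by exists kmax; rewrite lexx kk; split=> //; apply: fP; rewrite fu f2.
pose th := (glo kmax - f) / (glo kmax - gup kmin).
have den : 0 < glo kmax - gup kmin by rewrite subr_gt0 (lt_trans f1).
have th0 : 0 <= th by rewrite divr_ge0 ?ltW// subr_gt0.
have th1 : th <= 1 by rewrite ler_pdivrMr// mul1r lerD2l lerN2 ltW.
exists (th * kmin + (1 - th) * kmax); split.
  by move: kk; rewrite -subr_ge0 => kk;
    have := mulr_ge0 th0 kk; move: th1; rewrite -subr_ge0 => th1;
    have := mulr_ge0 th1 kk => *; apply/andP; split; lra.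
have -> : f = th * gup kmin + (1 - th) * glo kmax.
  by rewrite /th; field; rewrite gt_eqF.
have -> : a2 * a3 + (th * kmin + (1 - th) * kmax) =
   th * (a2 * a3 + kmin) + (1 - th) * (a2 * a3 + kmax) by ring.
have -> : a1 + r * d1 = th * (a1 + r * d1) + (1 - th) * (a1 + r * d1) by ring.
apply: mccormick_f_conv => //; apply: fP; rewrite lexx ?andbT /=.
  by rewrite glu// kmin0 (le_trans kk).
by rewrite glu// kmaxD andbT (le_trans kmin0).
Qed.

Lemma double_mccormickE : double_mccormick a1 b1 a2 b2 a3 b3 =
  region a1 b1 a2 b2 a3 b3 (dmc_lower c0 c1 a1 d1 al be de)
    (dmc_upper c0 c1 a1 d1 al be de).
Proof.
have zK (a b x : R) : a < b -> a + (x - a) / (b - a) * (b - a) = x.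
  by move=> ab; rewrite divfK ?subr_eq0 ?gt_eqF// addrC subrK.
apply/seteqP; split=> -[[[f x1] x2] x3];
  have := double_mccormick_affine f ((x1 - a1) / d1) ((x2 - a2) / d2)
    ((x3 - a3) / d3); rewrite !zK// => dmcP; first by move/dmcP.
by move=> H; apply/dmcP.
Qed.

Lemma vol4_double_mccormick : vol4 (double_mccormick a1 b1 a2 b2 a3 b3) =
  (d1 * d2 * d3 * (a1 * de / 6 + d1 * ((al + be) / 2 + 3 * de / 8) -
   d1 / (2 * D) * (2 * al ^+ 2 / 3 + 2 * be ^+ 2 / 3 + al * be +
     3 * de * (al + be) / 4 + de ^+ 2 / 3)))%:E.
Proof.
rewrite double_mccormickE; apply: vol4_region => //.
- exact: measurable_dmc_lower.
- exact: measurable_dmc_upper.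
- by move=> r s t ? ? ?; apply: dmc_lower_le_upper => //; exact: ltW.
- by move=> s t ? ?; exact: dmc_int1.
- by move=> t ?; exact: dmc_int2.
- exact: dmc_int3.
Qed.

End DoubleMcCormickRegion.

(** * The trilinear hull as a region *)

Section ConvexSets.
Context {R : realType} {E : lmodType R}.
Implicit Type C : set E.

Lemma convex_setP C : convex_set C <->
  forall x y (t : R), C x -> C y -> 0 <= t -> t <= 1 -> C (t *: x + (1 - t) *: y).
Proof.
split=> [cC x y t Cx Cy t0 t1|cC x y t].
  have := cC x y (Itv01 t0 t1); rewrite !in_setE; exact.
rewrite !in_setE => Cx Cy.
exact: (cC x y t%:num Cx Cy (ge0 _) (le1 _)).
Qed.

Lemma convex_set_sum C (l : seq (R * E)) (x : E) (w : R) : convex_set C ->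
  C x -> 0 <= w -> (forall k, k \in l -> 0 <= k.1 /\ C k.2) ->
  w + \sum_(k <- l) k.1 = 1 -> C (w *: x + \sum_(k <- l) k.1 *: k.2).
Proof.
move=> /convex_setP cC; elim: l x w => [|[v y] l IHl] x w Cx w0 Cl.
  by rewrite !big_nil addr0 => ->; rewrite scale1r addr0.
have [v0 Cy] := Cl (v, y) (mem_head _ _).
have {}Cl k : k \in l -> 0 <= k.1 /\ C k.2.
  by move=> kl; apply: Cl; rewrite inE kl orbT.
rewrite !big_cons !addrA /= => sum1.
have [wv0|wv0] := eqVneq (w + v) 0.
  have /eqP := wv0; rewrite paddr_eq0// => /andP[/eqP w_eq0 /eqP v_eq0].
  move: sum1; rewrite w_eq0 v_eq0 addr0 => sum1.
  by rewrite !scale0r addr0 -[X in X + _](scale0r x); exact: IHl.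
have wv_gt0 : 0 < w + v by rewrite lt0r wv0 addr_ge0.
have -> : w *: x + v *: y =
    (w + v) *: ((w / (w + v)) *: x + (1 - w / (w + v)) *: y).
  rewrite scalerDr !scalerA mulrBr mulr1 mulrCA divff// mulr1.
  by rewrite [w + v]addrC addrK.
apply: IHl => //; last exact: ltW.
apply: cC => //; first by rewrite divr_ge0// ltW.
by rewrite ler_pdivrMr// mul1r lerDl.
Qed.

Lemma sub_conv_hull (A : set E) : A `<=` conv_hull A.
Proof. exact: sub_smallest. Qed.

Lemma conv_hull_min (A C : set E) : convex_set C -> A `<=` C -> conv_hull A `<=` C.
Proof. by move=> cC AC; apply: smallest_sub. Qed.

Lemma convex_conv_hull (A : set E) : convex_set (conv_hull A).
Proof.
apply/convex_setP => x y t Ax Ay t0 t1 C CC; have /convex_setP := CC.1; apply=> //.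
  exact: Ax.
exact: Ay.
Qed.

End ConvexSets.

Section R4.
Context {R : realType}.

Lemma scaleR4 (t f x y z : R) :
  t *: ((f, x, y, z) : R * R * R * R) = (t * f, t * x, t * y, t * z).
Proof. by []. Qed.

Lemma addR4 (f x y z f' x' y' z' : R) :
  ((f, x, y, z) : R * R * R * R) + (f', x', y', z') =
  (f + f', x + x', y + y', z + z').
Proof. by []. Qed.

End R4.

(** * Both envelopes are attained in the hull *)

Section TrilinearHullRegion.
Context {R : realType}.
Variables a1 b1 a2 b2 a3 b3 : R.
Local Notation d1 := (b1 - a1).
Local Notation d2 := (b2 - a2).
Local Notation d3 := (b3 - a3).
Local Notation hull := (trilinear_hull a1 b1 a2 b2 a3 b3).

Lemma trilinear_hull_vertex x1 x2 x3 : x1 = a1 \/ x1 = b1 -> x2 = a2 \/ x2 = b2 ->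
  x3 = a3 \/ x3 = b3 -> hull (x1 * x2 * x3, x1, x2, x3).
Proof. by move=> *; apply: sub_conv_hull; exists x1, x2, x3. Qed.

Lemma trilinear_hull_between (f g h x1 x2 x3 : R) :
  hull (f, x1, x2, x3) -> hull (h, x1, x2, x3) -> f <= g <= h ->
  hull (g, x1, x2, x3).
Proof.
move=> Hf Hh /andP[fg gh].
have [fh|fh] := eqVneq f h.
  by have -> : g = f by apply/le_anti; rewrite fg fh gh.
have hf : 0 < h - f by rewrite subr_gt0 lt_neqAle fh (le_trans fg).
pose t := (h - g) / (h - f).
have t0 : 0 <= t by rewrite divr_ge0 ?subr_ge0// -subr_ge0 ltW.
have t1 : t <= 1 by rewrite ler_pdivrMr// mul1r lerD2l lerN2.
have := (convex_setP hull).1 (@convex_conv_hull _ _ _) _ _ t Hf Hh t0 t1.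
rewrite !scaleR4 addR4; congr hull; congr (_, _, _, _).
- by rewrite /t; field; rewrite gt_eqF.
- by ring.
- by ring.
- by ring.
Qed.

(** A digit 1 in an index selects the endpoint b, a digit 0 the endpoint a. Membership thus reduces
    to a probability on the vertices with marginals r, s, t. *)
Lemma trilinear_hull_weights w000 w001 w010 w011 w100 w101 w110 w111 f x1 x2 x3 :
  [/\ 0 <= w000, 0 <= w001, 0 <= w010 & 0 <= w011] ->
  [/\ 0 <= w100, 0 <= w101, 0 <= w110 & 0 <= w111] ->
  w000 + w001 + w010 + w011 + w100 + w101 + w110 + w111 = 1 ->
  f = w000 * (a1 * a2 * a3) + w001 * (a1 * a2 * b3) + w010 * (a1 * b2 * a3) +
      w011 * (a1 * b2 * b3) + w100 * (b1 * a2 * a3) + w101 * (b1 * a2 * b3) +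
      w110 * (b1 * b2 * a3) + w111 * (b1 * b2 * b3) ->
  x1 = a1 + (w100 + w101 + w110 + w111) * d1 ->
  x2 = a2 + (w010 + w011 + w110 + w111) * d2 ->
  x3 = a3 + (w001 + w011 + w101 + w111) * d3 ->
  hull (f, x1, x2, x3).
Proof.
move=> [H0 H1 H2 H3] [H4 H5 H6 H7] sum1 -> -> -> ->.
pose pt (x1 x2 x3 : R) := (x1 * x2 * x3, x1, x2, x3).
pose l := [:: (w001, pt a1 a2 b3); (w010, pt a1 b2 a3);
  (w011, pt a1 b2 b3); (w100, pt b1 a2 a3); (w101, pt b1 a2 b3);
  (w110, pt b1 b2 a3); (w111, pt b1 b2 b3)].
have hv : hull (pt a1 a2 a3) by apply: trilinear_hull_vertex; left.
have hl k : k \in l -> 0 <= k.1 /\ hull k.2.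
  by rewrite !inE => /or4P[|||/or4P[|||]] /eqP -> /=; split=> //;
    apply: trilinear_hull_vertex; (by left) || (by right).
have sl : w000 + \sum_(k <- l) k.1 = 1.
  by rewrite !big_cons big_nil /= -sum1; ring.
have := convex_set_sum (@convex_conv_hull _ _ _) hv H0 hl sl.
rewrite !big_cons big_nil /pt /= addr0 !scaleR4 !addR4; congr hull.
have -> : w000 = 1 - (w001 + w010 + w011 + w100 + w101 + w110 + w111).
  by rewrite -sum1; ring.
by congr (_, _, _, _) => /=; ring.
Qed.
Hypotheses (a1_ge0 : 0 <= a1) (a2_ge0 : 0 <= a2) (a3_ge0 : 0 <= a3).
Hypotheses (hab1 : a1 < b1) (hab2 : a2 < b2) (hab3 : a3 < b3).
Local Notation A1 := (a1 * d2 * d3).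
Local Notation A2 := (a2 * d1 * d3).
Local Notation A3 := (a3 * d1 * d2).
Hypotheses (A12 : A1 <= A2) (A13 : A1 <= A3).
Local Notation lower := (hull_lower (a1 * a2 * a3) (a2 * a3 * d1) (a1 * a3 * d2)
  (a1 * a2 * d3) A1 A2 A3 (d1 * d2 * d3)).
Local Notation upper := (hull_upper (a1 * a2 * a3) (a2 * a3 * d1) (a1 * a3 * d2)
  (a1 * a2 * d3) A1 A2 A3 (d1 * d2 * d3)).

Lemma trilinear_hull_lower r s t : 0 <= r <= 1 -> 0 <= s <= 1 -> 0 <= t <= 1 ->
  hull (lower r s t, a1 + r * d1, a2 + s * d2, a3 + t * d3).
Proof.
move=> /andP[r0 r1] /andP[s0 s1] /andP[t0 t1]; rewrite /hull_lower.
set S1 := pos (r - (1 - s - t)); set S2 := pos (r - (2 - s - t)).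
set p := pos (r - (1 - t)); set q := pos (r - (1 - s)).
have [S10 S1s] := pos_ge (r - (1 - s - t)).
have [S20 S2s] := pos_ge (r - (2 - s - t)).
have [p0 ps] := pos_ge (r - (1 - t)); have [q0 qs] := pos_ge (r - (1 - s)).
have posS1 := posP (r - (1 - s - t)); have posS2 := posP (r - (2 - s - t)).
have posp := posP (r - (1 - t)); have posq := posP (r - (1 - s)).
rewrite -/S1 -/S2 -/p -/q in S10 S1s S20 S2s p0 ps q0 qs posS1 posS2 posp posq.
(* This coupling gives the pairs (r, t) and (r, s) their least overlaps p and q, the triple its
   least overlap S2, and the all-zero vertex its least weight. The overlap of s and t is then S1 +
   S2 - p - q, which explains the coefficients A2 - A1 and A3 - A1. *)
apply: (@trilinear_hull_weights (1 - r - s - t + S1) (t + q - S1) (s + p - S1)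
  (S1 - p - q) (r - p - q + S2) (p - S2) (q - S2) S2); try by ring.
  clear -r0 r1 s0 s1 t0 t1 S10 S1s p0 ps q0 qs posS1 posp posq; split.
  - lra.
  - by case: posS1 => -[? ->]; lra.
  - by case: posS1 => -[? ->]; lra.
  - by case: posp => -[? ->]; case: posq => -[? ->]; lra.
clear -r0 r1 s0 s1 t0 t1 S20 S2s p0 ps q0 qs posS2 posp posq; split=> //.
- by case: posp => -[? ->]; case: posq => -[? ->]; lra.
- by case: posS2 => -[? ->]; lra.
- by case: posS2 => -[? ->]; lra.
Qed.

Lemma trilinear_hull_upper r s t : 0 <= r <= 1 -> 0 <= s <= 1 -> 0 <= t <= 1 ->
  hull (upper r s t, a1 + r * d1, a2 + s * d2, a3 + t * d3).
Proof.
move=> /andP[r0 r1] /andP[s0 s1] /andP[t0 t1]; rewrite /hull_upper.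
set m23 := s - pos (s - t); set m13 := r - pos (r - t).
set m12 := r - pos (r - s); set m := r - pos (r - m23).
have pos23 := posP (s - t); have pos13 := posP (r - t).
have pos12 := posP (r - s); have posm := posP (r - m23).
have [? ?] := pos_ge (s - t); have [? ?] := pos_ge (r - t).
have [? ?] := pos_ge (r - s); have [? ?] := pos_ge (r - m23).
have [m23s m23t] : m23 <= s /\ m23 <= t by rewrite /m23; split; lra.
have [m13r m13t] : m13 <= r /\ m13 <= t by rewrite /m13; split; lra.
have [m12r m12s] : m12 <= r /\ m12 <= s by rewrite /m12; split; lra.
have [mr mm23] : m <= r /\ m <= m23 by rewrite /m; split; lra.
(* With the inequalities above, these alternatives characterize the minima after their bodies are
   cleared. *)
have e23 : m23 = t \/ m23 = s.
  by rewrite /m23; case: pos23 => -[_ ->]; [left|right]; lra.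
have e13 : m13 = t \/ m13 = r.
  by rewrite /m13; case: pos13 => -[_ ->]; [left|right]; lra.
have e12 : m12 = s \/ m12 = r.
  by rewrite /m12; case: pos12 => -[_ ->]; [left|right]; lra.
have em : m = m23 \/ m = r.
  by rewrite /m; case: posm => -[_ ->]; [left|right]; lra.
(* The comonotone coupling of the three coordinates. *)
apply: (@trilinear_hull_weights (1 - r - s - t + m12 + m13 + m23 - m)
  (t - m13 - m23 + m) (s - m12 - m23 + m) (m23 - m) (r - m12 - m13 + m)
  (m13 - m) (m12 - m) m); try by ring.
  clearbody m m12 m13 m23;
  clear -r0 r1 s0 s1 t0 t1 m23s m23t m13r m13t m12r m12s mr mm23 e23 e13 e12 em.
  split.
  - by case: em => ?; case: e12 => ?; case: e13 => ?; case: e23 => ?; lra.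
  - by case: em => ?; lra.
  - by case: em => ?; lra.
  - lra.
clearbody m m12 m13 m23;
  clear -r0 r1 s0 s1 t0 t1 m23s m23t m13r m13t m12r m12s mr mm23 e23 e13 e12 em.
split.
- by case: em => ?; case: e23 => ?; lra.
- by case: e13 => ?; lra.
- by case: e12 => ?; lra.
- by case: em => ?; case: e23 => ?; lra.
Qed.

End TrilinearHullRegion.

(** * Convexity of the lower envelope and concavity of the upper one *)

Section HullFunctionsConvexity.
Context {R : realType}.

Lemma le_pos (x y : R) : x <= y -> pos x <= pos y.
Proof.
by move=> xy; have [? ?] := pos_ge y; have [[? ->]|[? ->]] := posP x; lra.
Qed.

Lemma pos_convex (l x y : R) : 0 <= l -> l <= 1 ->
  pos (l * x + (1 - l) * y) <= l * pos x + (1 - l) * pos y.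
Proof.
move=> l0 l1; have l1' : 0 <= 1 - l by rewrite subr_ge0.
have [x0 x1] := pos_ge x; have [y0 y1] := pos_ge y.
rewrite /pos ge_max addr_ge0 ?mulr_ge0//= lerD// ler_wpM2l//.
Qed.

Variables c0 c1 c2 c3 A1 A2 A3 E : R.
Hypotheses (A1_ge0 : 0 <= A1) (A12 : A1 <= A2) (A13 : A1 <= A3) (E_ge0 : 0 <= E).
Local Notation lower := (hull_lower c0 c1 c2 c3 A1 A2 A3 E).
Local Notation upper := (hull_upper c0 c1 c2 c3 A1 A2 A3 E).
Variables l r s t r' s' t' : R.
Hypotheses (l0 : 0 <= l) (l1 : l <= 1).
Local Notation r'' := (l * r + (1 - l) * r').
Local Notation s'' := (l * s + (1 - l) * s').
Local Notation t'' := (l * t + (1 - l) * t').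

(** The function is affine plus positive parts of affine forms with coefficients A1, A2 - A1, A3 -
    A1 and E; the ordering of the Ai makes these nonnegative. *)
Lemma hull_lower_convex :
  lower r'' s'' t'' <= l * lower r s t + (1 - l) * lower r' s' t'.
Proof.
have H1 := pos_convex (r - (1 - s - t)) (r' - (1 - s' - t')) l0 l1.
have H2 := pos_convex (r - (2 - s - t)) (r' - (2 - s' - t')) l0 l1.
have H3 := pos_convex (r - (1 - t)) (r' - (1 - t')) l0 l1.
have H4 := pos_convex (r - (1 - s)) (r' - (1 - s')) l0 l1.
have e1 : l * (r - (1 - s - t)) + (1 - l) * (r' - (1 - s' - t')) =
  r'' - (1 - s'' - t'') by ring.
have e2 : l * (r - (2 - s - t)) + (1 - l) * (r' - (2 - s' - t')) =
  r'' - (2 - s'' - t'') by ring.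
have e3 : l * (r - (1 - t)) + (1 - l) * (r' - (1 - t')) = r'' - (1 - t'') by ring.
have e4 : l * (r - (1 - s)) + (1 - l) * (r' - (1 - s')) = r'' - (1 - s'') by ring.
rewrite {}e1 in H1; rewrite {}e2 in H2; rewrite {}e3 in H3; rewrite {}e4 in H4.
move: H1 H2 H3 H4; rewrite -subr_ge0 => H1; rewrite -subr_ge0 => H2.
rewrite -subr_ge0 => H3; rewrite -subr_ge0 => H4.
have A12' : 0 <= A2 - A1 by rewrite subr_ge0.
have A13' : 0 <= A3 - A1 by rewrite subr_ge0.
rewrite -subr_ge0; have := addr_ge0 (addr_ge0
  (addr_ge0 (mulr_ge0 A1_ge0 (addr_ge0 H1 H2)) (mulr_ge0 A12' H3))
  (mulr_ge0 A13' H4)) (mulr_ge0 E_ge0 H2).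
by apply: etrans; congr (_ <= _); rewrite /hull_lower; ring.
Qed.

(** Minima are concave. For the nested minimum, concavity of min(s, t) passes through the monotone
    function [pos] before its convexity is used. *)
Lemma hull_upper_concave :
  l * upper r s t + (1 - l) * upper r' s' t' <= upper r'' s'' t''.
Proof.
have H1 := pos_convex (s - t) (s' - t') l0 l1.
have H2 := pos_convex (r - t) (r' - t') l0 l1.
have H3 := pos_convex (r - s) (r' - s') l0 l1.
have H4 := pos_convex (r - (s - pos (s - t))) (r' - (s' - pos (s' - t'))) l0 l1.
have e1 : l * (s - t) + (1 - l) * (s' - t') = s'' - t'' by ring.
have e2 : l * (r - t) + (1 - l) * (r' - t') = r'' - t'' by ring.
have e3 : l * (r - s) + (1 - l) * (r' - s') = r'' - s'' by ring.
rewrite {}e1 in H1; rewrite {}e2 in H2; rewrite {}e3 in H3.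
have {}H4 : pos (r'' - (s'' - pos (s'' - t''))) <=
    l * pos (r - (s - pos (s - t))) + (1 - l) * pos (r' - (s' - pos (s' - t'))).
  apply: le_trans H4; apply: le_pos; move: H1.
  by rewrite -subr_ge0 => H1; rewrite -subr_ge0; move: H1; apply: etrans;
    congr (_ <= _); ring.
move: H1 H2 H3 H4; rewrite -subr_ge0 => H1; rewrite -subr_ge0 => H2.
rewrite -subr_ge0 => H3; rewrite -subr_ge0 => H4.
have A20 := le_trans A1_ge0 A12; have A30 := le_trans A1_ge0 A13.
rewrite -subr_ge0; have := addr_ge0 (addr_ge0
  (addr_ge0 (mulr_ge0 A1_ge0 H1) (mulr_ge0 A20 H2))
  (mulr_ge0 A30 H3)) (mulr_ge0 E_ge0 H4).
by apply: etrans; congr (_ <= _); rewrite /hull_upper; ring.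
Qed.

End HullFunctionsConvexity.

(** * The hull as the region between its envelopes, and its volume *)

Section TrilinearHullVolume.
Context {R : realType}.
Variables a1 b1 a2 b2 a3 b3 : R.
Local Notation d1 := (b1 - a1).
Local Notation d2 := (b2 - a2).
Local Notation d3 := (b3 - a3).
Local Notation hull := (trilinear_hull a1 b1 a2 b2 a3 b3).

Hypotheses (a1_ge0 : 0 <= a1) (a2_ge0 : 0 <= a2) (a3_ge0 : 0 <= a3).
Hypotheses (hab1 : a1 < b1) (hab2 : a2 < b2) (hab3 : a3 < b3).
Local Notation A1 := (a1 * d2 * d3).
Local Notation A2 := (a2 * d1 * d3).
Local Notation A3 := (a3 * d1 * d2).
Hypotheses (A12 : A1 <= A2) (A13 : A1 <= A3).
Local Notation lower := (hull_lower (a1 * a2 * a3) (a2 * a3 * d1) (a1 * a3 * d2)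
  (a1 * a2 * d3) A1 A2 A3 (d1 * d2 * d3)).
Local Notation upper := (hull_upper (a1 * a2 * a3) (a2 * a3 * d1) (a1 * a3 * d2)
  (a1 * a2 * d3) A1 A2 A3 (d1 * d2 * d3)).

Let d1_gt0 : 0 < d1. Proof. by rewrite subr_gt0. Qed.
Let d2_gt0 : 0 < d2. Proof. by rewrite subr_gt0. Qed.
Let d3_gt0 : 0 < d3. Proof. by rewrite subr_gt0. Qed.
Let A1_ge0 : 0 <= A1. Proof. by rewrite !mulr_ge0// ltW. Qed.
Let E_ge0 : 0 <= d1 * d2 * d3. Proof. by rewrite !mulr_ge0// ltW. Qed.

Lemma convex_region : convex_set (region a1 b1 a2 b2 a3 b3 lower upper).
Proof.
apply/convex_setP => -[[[f x1] x2] x3] [[[f' x1'] x2'] x3'] l Hx Hy l0 l1.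
have l1' : 0 <= 1 - l by rewrite subr_ge0.
move: Hx Hy; rewrite scaleR4 /region /=.
have zE (a b x x' : R) : (l * x + (1 - l) * x' - a) / (b - a) =
  l * ((x - a) / (b - a)) + (1 - l) * ((x' - a) / (b - a)) by ring.
have z01 (z z' : R) : 0 <= z <= 1 -> 0 <= z' <= 1 -> 0 <= l * z + (1 - l) * z' <= 1.
  by move=> ? ?; apply/andP; split; nra.
rewrite !zE.
move=> [r01 s01 t01 /andP[fl fu]] [r01' s01' t01' /andP[fl' fu']].
split; [exact: z01|exact: z01|exact: z01|].
apply/andP; split.
  apply: le_trans; first exact: hull_lower_convex.
  by rewrite lerD// ler_wpM2l.
apply: le_trans; last exact: hull_upper_concave.
by rewrite lerD// ler_wpM2l.
Qed.

Ltac pos_numerals := repeat match goal with |- context [pos ?y] => first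
  [rewrite (@pos_id R y); last lra | rewrite (@pos_eq0 R y); last lra] end.

(** The region is convex, so only the eight vertices need checking; there every positive part has a
    numerical argument. *)
Lemma trilinear_hull_sub_region :
  hull `<=` region a1 b1 a2 b2 a3 b3 lower upper.
Proof.
apply: conv_hull_min; first exact: convex_region.
have z0 (a b : R) : (a - a) / (b - a) = 0 by rewrite subrr mul0r.
have z1 (a b : R) : a < b -> (b - a) / (b - a) = 1.
  by move=> ab; rewrite divff// subr_eq0 gt_eqF.
move=> _ [x1 [x2 [x3 [[] -> [] -> [] -> ->]]]]; rewrite /region /=;
  rewrite ?z0 ?z1// /hull_lower /hull_upper; (split; [lra|lra|lra|]); pos_numerals;
  apply/andP; split; lra.
Qed.

(** For the reverse inclusion, the hull contains both graphs, hence every vertical segment between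
    them. *)
Lemma trilinear_hullE : hull = region a1 b1 a2 b2 a3 b3 lower upper.
Proof.
apply/seteqP; split; first exact: trilinear_hull_sub_region.
have zK (a b x : R) : a < b -> a + (x - a) / (b - a) * (b - a) = x.
  by move=> ab; rewrite divfK ?subr_eq0 ?gt_eqF// addrC subrK.
move=> [[[f x1] x2] x3] [r01 s01 t01].
have := @trilinear_hull_lower R a1 b1 a2 b2 a3 b3 _ _ _ r01 s01 t01.
have := @trilinear_hull_upper R a1 b1 a2 b2 a3 b3 _ _ _ r01 s01 t01.
rewrite !zK//; move=> Hu Hl; exact: trilinear_hull_between Hl Hu.
Qed.

Lemma vol4_trilinear_hull : vol4 hull =
  (d1 * d2 * d3 * (A1 / 12 + A2 / 6 + A3 / 6 + 5 * (d1 * d2 * d3) / 24))%:E.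
Proof.
rewrite trilinear_hullE; apply: vol4_region => //.
- exact: measurable_hull_lower.
- exact: measurable_hull_upper.
- by move=> r s t ? ? ?; exact: hull_lower_le_upper.
- by move=> s t ? ?; exact: hull_int1.
- by move=> t ?; exact: hull_int2.
- exact: hull_int3.
Qed.

End TrilinearHullVolume.

(** * Extreme points *)

Section ExtremePoints.
Context {R : realType} {E : lmodType R}.
Implicit Type A : set E.

Lemma extreme_conv2 A p y z (t : R) : extreme_points A p -> A y -> A z ->
  0 <= t -> t <= 1 -> p = t *: y + (1 - t) *: z -> p = y \/ p = z.
Proof.
move=> [_ ext] Ay Az; rewrite le_eqVlt => /orP[/eqP <- _ ->|t0].
  by right; rewrite scale0r add0r subr0 scale1r.
rewrite le_eqVlt => /orP[/eqP -> ->|t1 pE].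
  by left; rewrite subrr scale0r addr0 scale1r.
left; rewrite pE (ext y z t)//.
by rewrite -scalerDl addrC subrK scale1r.
Qed.

(** Induction merges two points at a time as for convex sums; if p is the merged point, extremality
    splits it back into one of the two. *)
Lemma extreme_conv_sum A p (l : seq (R * E)) (x : E) (w : R) : convex_set A ->
  extreme_points A p -> A x -> 0 <= w ->
  (forall k, k \in l -> 0 <= k.1 /\ A k.2) -> w + \sum_(k <- l) k.1 = 1 ->
  p = w *: x + \sum_(k <- l) k.1 *: k.2 ->
  p = x \/ exists2 k, k \in l & p = k.2.
Proof.
move=> /convex_setP cA ext; elim: l x w => [|[v y] l IHl] x w Ax w0 Al.
  by rewrite !big_nil addr0 => ->; rewrite scale1r addr0; left.
have [v0 Ay] := Al (v, y) (mem_head _ _).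
have {}Al k : k \in l -> 0 <= k.1 /\ A k.2.
  by move=> kl; apply: Al; rewrite inE kl orbT.
rewrite !big_cons !addrA /= => sum1.
have tl : p = x \/ p = y \/ (exists2 k, k \in l & p = k.2) ->
    p = x \/ exists2 k, k \in (v, y) :: l & p = k.2.
  move=> [->|[->|[k kl ->]]]; [by left| |]; right.
    by exists (v, y) => //; exact: mem_head.
  by exists k => //; rewrite inE kl orbT.
have [wv0|wv0] := eqVneq (w + v) 0.
  have /eqP := wv0; rewrite paddr_eq0// => /andP[/eqP w_eq0 /eqP v_eq0].
  have {}sum1 : 0 + \sum_(k <- l) k.1 = 1.
    by rewrite -sum1 w_eq0 v_eq0 addr0.
  move=> pE; apply: tl; have [||] := IHl x 0 Ax (lexx _) Al sum1.
  - by rewrite pE w_eq0 v_eq0 !scale0r addr0.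
  - by left.
  - by right; right.
have wv_gt0 : 0 < w + v by rewrite lt0r wv0 addr_ge0.
have -> : w *: x + v *: y =
    (w + v) *: ((w / (w + v)) *: x + (1 - w / (w + v)) *: y).
  rewrite scalerDr !scalerA mulrBr mulr1 mulrCA divff// mulr1.
  by rewrite [w + v]addrC addrK.
have q0 : 0 <= w / (w + v) by rewrite divr_ge0// ltW.
have q1 : w / (w + v) <= 1 by rewrite ler_pdivrMr// mul1r lerDl.
move=> pE; apply: tl.
have [pz|] := IHl _ _ (cA x y _ Ax Ay q0 q1) (ltW wv_gt0) Al sum1 pE.
  by have [|] := extreme_conv2 ext Ax Ay q0 q1 pz; [left|right; left].
by right; right.
Qed.

End ExtremePoints.

(** The supporting hyperplane principle: an affine form of constant sign that vanishes inside a
    segment vanishes at both ends. *)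
Lemma conv_eq0 (R : realType) (t u v : R) : 0 < t -> t < 1 ->
  (0 <= u /\ 0 <= v) \/ (u <= 0 /\ v <= 0) -> t * u + (1 - t) * v = 0 ->
  u = 0 /\ v = 0.
Proof.
move=> t0; rewrite -subr_gt0 => t1 [[u0 v0]|[u0 v0]] /eqP.
  rewrite paddr_eq0 ?(mulr_ge0 (ltW _))// => /andP[].
  by rewrite !mulf_eq0 (gt_eqF t0) (gt_eqF t1) => /eqP ? /eqP ?.
rewrite naddr_eq0 ?(mulr_ge0_le0 (ltW _))// => /andP[].
by rewrite !mulf_eq0 (gt_eqF t0) (gt_eqF t1) => /eqP ? /eqP ?.
Qed.

(** * Extreme points of the double-McCormick relaxation *)

Section DoubleMcCormickExtreme.
Context {R : realType}.
Variables a1 b1 a2 b2 a3 b3 : R.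
Hypotheses (a1_ge0 : 0 <= a1) (a2_ge0 : 0 <= a2) (a3_ge0 : 0 <= a3).
Hypotheses (hab1 : a1 < b1) (hab2 : a2 < b2) (hab3 : a3 < b3).
Local Notation D := (b2 * b3 - a2 * a3).
Local Notation dmc := (double_mccormick a1 b1 a2 b2 a3 b3).

Let D_gt0 : 0 < D.
Proof.
rewrite subr_gt0; apply: (@le_lt_trans _ _ (a2 * b3)).
  by rewrite ler_wpM2l// ltW.
by rewrite ltr_pM2r// (le_lt_trans a3_ge0).
Qed.

Lemma convex_double_mccormick : convex_set dmc.
Proof.
apply/convex_setP => -[[[f x1] x2] x3] [[[f' x1'] x2'] x3'] t.
move=> [w [Hw Hf]] [w' [Hw' Hf']] t0 t1.
suff : dmc (t * f + (1 - t) * f', t * x1 + (1 - t) * x1', t * x2 + (1 - t) * x2',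
    t * x3 + (1 - t) * x3') by [].
exists (t * w + (1 - t) * w').
by split; [exact: mccormick_w_conv|exact: mccormick_f_conv].
Qed.

(* The point over (x2, x3) at w = x2 * x3 lying on the segment that joins the
   point with x1 = y0 of the edge w = a2 * a3 to the point with x1 = y1 of the
   edge w = b2 * b3 of the McCormick tetrahedron in (f, w, x1). *)
Definition dmc_point (x2 x3 y0 y1 : R) : R * R * R * R :=
  let h := (x2 * x3 - a2 * a3) / D in
  ((1 - h) * (a2 * a3) * y0 + h * (b2 * b3) * y1, (1 - h) * y0 + h * y1, x2, x3).

(** With w = x2 x3, the slacks for w are products of box slacks, and those for f are D h or D (1 -
    h) times the distance of y1 or y0 to an endpoint. *)
Lemma dmc_point_in x2 x3 y0 y1 : a2 <= x2 <= b2 -> a3 <= x3 <= b3 ->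
  a1 <= y0 <= b1 -> a1 <= y1 <= b1 -> dmc (dmc_point x2 x3 y0 y1).
Proof.
move=> /andP[x2a x2b] /andP[x3a x3b] /andP[y0a y0b] /andP[y1a y1b].
have DN0 : D != 0 by rewrite gt_eqF.
exists (x2 * x3); split.
  move: x2a x2b x3a x3b; rewrite -[a2 <= _]subr_ge0 -[_ <= b2]subr_ge0.
  rewrite -[a3 <= _]subr_ge0 -[_ <= b3]subr_ge0 => x2a x2b x3a x3b.
  have := mulr_ge0 x2a x3a; have := mulr_ge0 x2a x3b.
  have := mulr_ge0 x2b x3a; have := mulr_ge0 x2b x3b.
  by move=> *; split; lra.
set h := (x2 * x3 - a2 * a3) / D.
have h0 : 0 <= h by rewrite divr_ge0 ?(ltW D_gt0)// subr_ge0 ler_pM.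
have h1 : 0 <= 1 - h.
  rewrite subr_ge0 ler_pdivrMr// mul1r lerD2r ler_pM//.
    exact: le_trans x2a.
  exact: le_trans x3a.
have -> : x2 * x3 = a2 * a3 + h * D by rewrite /h divfK// addrC subrK.
have Dh0 := mulr_ge0 (ltW D_gt0) h0; have Dh1 := mulr_ge0 (ltW D_gt0) h1.
have sub x y : x <= y -> 0 <= y - x :> R by rewrite subr_ge0.
have := mulr_ge0 Dh0 (sub _ _ y1a); have := mulr_ge0 Dh0 (sub _ _ y1b).
have := mulr_ge0 Dh1 (sub _ _ y0a); have := mulr_ge0 Dh1 (sub _ _ y0b).
by move=> H1 H2 H3 H4; split; [move: H4|move: H3|move: H2|move: H1];
  apply: etrans; congr (_ <= _); ring.
Qed.

Lemma dmc_point_affine0 x2 x3 y0 y0' y1 t :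
  dmc_point x2 x3 (t * y0 + (1 - t) * y0') y1 =
  t *: dmc_point x2 x3 y0 y1 + (1 - t) *: dmc_point x2 x3 y0' y1.
Proof. by rewrite /dmc_point !scaleR4; congr (_, _, _, _) => /=; ring. Qed.

Lemma dmc_point_affine1 x2 x3 y0 y1 y1' t :
  dmc_point x2 x3 y0 (t * y1 + (1 - t) * y1') =
  t *: dmc_point x2 x3 y0 y1 + (1 - t) *: dmc_point x2 x3 y0 y1'.
Proof. by rewrite /dmc_point !scaleR4; congr (_, _, _, _) => /=; ring. Qed.

Lemma mccormick_w_box w x2 x3 : mccormick_w a2 b2 a3 b3 w x2 x3 ->
  a2 <= x2 <= b2 /\ a3 <= x3 <= b3.
Proof.
move=> [H1 H2 H3 H4].
have d2_gt0 : 0 < b2 - a2 by rewrite subr_gt0.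
have d3_gt0 : 0 < b3 - a3 by rewrite subr_gt0.
have x2a : 0 <= x2 - a2 by rewrite -(pmulr_rge0 _ d3_gt0); lra.
have x2b : 0 <= b2 - x2 by rewrite -(pmulr_rge0 _ d3_gt0); lra.
have x3a : 0 <= x3 - a3 by rewrite -(pmulr_rge0 _ d2_gt0); lra.
have x3b : 0 <= b3 - x3 by rewrite -(pmulr_rge0 _ d2_gt0); lra.
by rewrite -(subr_ge0 a2) -(subr_ge0 x2) -(subr_ge0 a3) -(subr_ge0 x3) x2a x2b x3a.
Qed.

(** Solves for y by division; when c = 0 the bounds force F = 0 and a1 serves as y. *)
Lemma segment_param (c F : R) : 0 <= c -> 0 <= F -> F <= c * (b1 - a1) ->
  exists2 y, a1 <= y <= b1 & F = c * (y - a1).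
Proof.
rewrite le_eqVlt => /orP[/eqP <-|c0] F0.
  by rewrite mul0r => F0'; exists a1; [rewrite lexx ltW|
    rewrite mul0r; apply/le_anti; rewrite F0 F0'].
rewrite mulrC -ler_pdivrMr// => Fc.
exists (a1 + F / c); last by rewrite addrAC subrr add0r mulrC divfK// gt_eqF.
rewrite lerDl divr_ge0// ?(ltW c0)//=; lra.
Qed.

(** The four slacks for w, divided by (b2 - a2)(b3 - a3), are the barycentric coordinates of (w, x2,
    x3) in its tetrahedron. The first two bounds on f determine y1, the last two y0, and both are
    shared by all four vertices. *)
Lemma dmc_decomposition p : dmc p -> exists y0 y1 l00 l01 l10 l11,
  [/\ a1 <= y0 <= b1, a1 <= y1 <= b1,
      [/\ 0 <= l00, 0 <= l01, 0 <= l10 & 0 <= l11],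
      l00 + (l01 + (l10 + l11)) = 1 &
      p = l00 *: dmc_point a2 a3 y0 y1 + (l01 *: dmc_point a2 b3 y0 y1 +
        (l10 *: dmc_point b2 a3 y0 y1 + l11 *: dmc_point b2 b3 y0 y1))].
Proof.
case: p => [[[f x1] x2] x3] [w [Hw [F1 F2 F3 F4]]].
have [/andP[x2a x2b] /andP[x3a x3b]] := mccormick_w_box Hw.
have [H1 H2 H3 H4] := Hw.
have DN0 : D != 0 by rewrite gt_eqF.
have d2_gt0 : 0 < b2 - a2 by rewrite subr_gt0.
have d3_gt0 : 0 < b3 - a3 by rewrite subr_gt0.
have b3_ge0 := le_trans a3_ge0 (ltW hab3).
have wa : 0 <= w - a2 * a3.
  by have := ler_wpM2l a3_ge0 x2a; have := ler_wpM2l a2_ge0 x3a; lra.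
have wb : 0 <= b2 * b3 - w.
  by have := ler_wpM2l b3_ge0 x2b; have := ler_wpM2l a2_ge0 x3b; lra.
have [y1 y1ab E1] : exists2 y, a1 <= y <= b1 &
    f - a1 * w - a2 * a3 * x1 + a1 * a2 * a3 = (w - a2 * a3) * (y - a1).
  by apply: segment_param => //; lra.
have [y0 y0ab E3] : exists2 y, a1 <= y <= b1 &
    - f + a1 * w + b2 * b3 * x1 - a1 * b2 * b3 = (b2 * b3 - w) * (y - a1).
  by apply: segment_param => //; lra.
have x1E : x1 = ((b2 * b3 - w) * y0 + (w - a2 * a3) * y1) / D.
  by apply: (mulIf DN0); rewrite divfK//; lra.
have fE : f = a1 * w + a2 * a3 * x1 - a1 * a2 * a3 + (w - a2 * a3) * (y1 - a1).
  by lra.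
pose de := (b2 - a2) * (b3 - a3).
have de_gt0 : 0 < de by rewrite mulr_gt0.
have deN0 : (b2 - a2 != 0) /\ (b3 - a3 != 0) by rewrite !gt_eqF.
exists y0, y1, ((w - b3 * x2 - b2 * x3 + b2 * b3) / de),
  ((- w + a3 * x2 + b2 * x3 - b2 * a3) / de),
  ((- w + b3 * x2 + a2 * x3 - a2 * b3) / de),
  ((w - a3 * x2 - a2 * x3 + a2 * a3) / de).
split=> //.
- by split; rewrite divr_ge0// ltW.
- by rewrite /de; field; rewrite deN0.1 deN0.2.
rewrite fE x1E /dmc_point !scaleR4.
congr (_, _, _, _) => /=; rewrite /de; field; rewrite ?DN0 ?deN0.1 ?deN0.2//.
Qed.

Definition dmc_corner (x2 x3 y0 y1 : R) :=
  [/\ x2 = a2 \/ x2 = b2, x3 = a3 \/ x3 = b3, y0 = a1 \/ y0 = b1 &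
      y1 = a1 \/ y1 = b1].

Let corner_bounds (a b x : R) : a < b -> x = a \/ x = b -> a <= x <= b.
Proof. by move=> ab [] ->; rewrite ?lexx ltW. Qed.

(** Extremality is applied three times: to the barycentric combination, then along y0, then along
    y1. *)
Lemma extreme_dmc_corner p : extreme_points dmc p ->
  exists x2 x3 y0 y1, dmc_corner x2 x3 y0 y1 /\ p = dmc_point x2 x3 y0 y1.
Proof.
move=> ext.
have /dmc_decomposition[y0 [y1 [l00 [l01 [l10 [l11]]]]]] := ext.1.
move=> [y0ab y1ab [l00_ge0 l01_ge0 l10_ge0 l11_ge0] sum1 pE].
have inq x2 x3 z0 z1 : x2 = a2 \/ x2 = b2 -> x3 = a3 \/ x3 = b3 ->
    a1 <= z0 <= b1 -> a1 <= z1 <= b1 -> dmc (dmc_point x2 x3 z0 z1).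
  by move=> *; apply: dmc_point_in => //; exact: corner_bounds.
have a1ab : a1 <= a1 <= b1 by rewrite lexx ltW.
have b1ab : a1 <= b1 <= b1 by rewrite lexx ltW.
have [x2 [x3 [x2E x3E {}pE]]] : exists x2 x3,
    [/\ x2 = a2 \/ x2 = b2, x3 = a3 \/ x3 = b3 & p = dmc_point x2 x3 y0 y1].
  have := @extreme_conv_sum R _ dmc p [:: (l01, dmc_point a2 b3 y0 y1);
    (l10, dmc_point b2 a3 y0 y1); (l11, dmc_point b2 b3 y0 y1)]
    (dmc_point a2 a3 y0 y1) l00 convex_double_mccormick ext.
  rewrite !big_cons !big_nil /= !addr0.
  case=> // [|k|->|[k]].
  - by apply: inq => //; left.
  - by rewrite !inE => /or3P[] /eqP ->; split=> //; apply: inq; auto.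
  - by exists a2, a3; split; auto.
  - by rewrite !inE => /or3P[] /eqP -> /= ->;
    [exists a2, b3|exists b2, a3|exists b2, b3]; split; auto.
pose t y := (b1 - y) / (b1 - a1).
have tE y : t y * a1 + (1 - t y) * b1 = y.
  by rewrite /t; field; rewrite subr_eq0 gt_eqF.
have t01 y : a1 <= y <= b1 -> 0 <= t y /\ t y <= 1.
  move=> /andP[ya yb]; have ba0 : 0 < b1 - a1 by rewrite subr_gt0.
  by rewrite divr_ge0 ?subr_ge0 ?(ltW hab1)// ler_pdivrMr// mul1r lerD2l lerN2.
have [t0 t1] := t01 y0 y0ab; have [u0 u1] := t01 y1 y1ab.
have [z0 z0E {}pE] : exists2 z0, z0 = a1 \/ z0 = b1 & p = dmc_point x2 x3 z0 y1.
  move: pE; rewrite -(tE y0) dmc_point_affine0.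
  by case/(extreme_conv2 ext _ _ t0 t1);
    [exact: inq|exact: inq|exists a1|exists b1]; auto.
have z0ab := corner_bounds hab1 z0E.
have [z1 z1E {}pE] : exists2 z1, z1 = a1 \/ z1 = b1 & p = dmc_point x2 x3 z0 z1.
  move: pE; rewrite -(tE y1) dmc_point_affine1.
  by case/(extreme_conv2 ext _ _ u0 u1);
    [exact: inq|exact: inq|exists a1|exists b1]; auto.
by exists x2, x3, z0, z1.
Qed.

(** The four hyperplanes are one face each for x2 and x3, then one tight bound on f for each of y1
    and y0. *)
Lemma dmc_corner_extreme x2 x3 y0 y1 : dmc_corner x2 x3 y0 y1 ->
  extreme_points dmc (dmc_point x2 x3 y0 y1).
Proof.
move=> [x2E x3E y0E y1E]; split.
  by apply: dmc_point_in; exact: corner_bounds.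
move=> [[[f z1] z2] z3] [[[f' z1'] z2'] z3'] t [w [Hw Hf]] [w' [Hw' Hf']] t0 t1.
have DN0 : D != 0 by rewrite gt_eqF.
set h := (x2 * x3 - a2 * a3) / D.
move=> pE.
have fE : (1 - h) * (a2 * a3) * y0 + h * (b2 * b3) * y1 = t * f + (1 - t) * f' :=
  congr1 (fun p => p.1.1.1) pE.
have z1E : (1 - h) * y0 + h * y1 = t * z1 + (1 - t) * z1' :=
  congr1 (fun p => p.1.1.2) pE.
have z2E : x2 = t * z2 + (1 - t) * z2' := congr1 (fun p => p.1.2) pE.
have z3E : x3 = t * z3 + (1 - t) * z3' := congr1 (fun p => p.2) pE.
clear pE.
have [/andP[z2a z2b] /andP[z3a z3b]] := mccormick_w_box Hw.
have [/andP[z2a' z2b'] /andP[z3a' z3b']] := mccormick_w_box Hw'.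
have [] : z2 - x2 = 0 /\ z2' - x2 = 0.
  apply: (conv_eq0 t0 t1); last by move: z2E; lra.
  by case: x2E => ->; [left|right]; split; lra.
move=> /subr0_eq ? /subr0_eq ?; subst z2 z2'.
have [] : z3 - x3 = 0 /\ z3' - x3 = 0.
  apply: (conv_eq0 t0 t1); last by move: z3E; lra.
  by case: x3E => ->; [left|right]; split; lra.
move=> /subr0_eq ? /subr0_eq ?; subst z3 z3'.
(* At a corner of the (x2, x3) box the lower and upper bounds on w coincide. *)
have w_corner v : mccormick_w a2 b2 a3 b3 v x2 x3 -> v = x2 * x3.
  by move=> []; case: x2E => ->; case: x3E => -> *; lra.
rewrite (w_corner _ Hw) in Hf; rewrite (w_corner _ Hw') in Hf'.
move: Hf Hf' => [F1 F2 F3 F4] [F1' F2' F3' F4'].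
have wE : x2 * x3 = a2 * a3 + h * D by rewrite /h divfK// addrC subrK.
(* For y1 = a1 this form is the first slack, for y1 = b1 minus the second, so its sign is constant
   either way. *)
have [e1 e1'] : f - y1 * (x2 * x3) - a2 * a3 * z1 + y1 * a2 * a3 = 0 /\
    f' - y1 * (x2 * x3) - a2 * a3 * z1' + y1 * a2 * a3 = 0.
  apply: (conv_eq0 t0 t1).
    clear Hw Hw' F3 F4 F3' F4' fE z1E wE.
    by case: y1E => ->; [left|right]; split; lra.
  transitivity (t * f + (1 - t) * f' - y1 * (x2 * x3) -
    a2 * a3 * (t * z1 + (1 - t) * z1') + y1 * a2 * a3); first by ring.
  by rewrite -fE -z1E wE; ring.
have [e2 e2'] : f - y0 * (x2 * x3) - b2 * b3 * z1 + y0 * b2 * b3 = 0 /\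
    f' - y0 * (x2 * x3) - b2 * b3 * z1' + y0 * b2 * b3 = 0.
  apply: (conv_eq0 t0 t1).
    clear Hw Hw' F1 F2 F1' F2' fE z1E wE e1 e1'.
    by case: y0E => ->; [right|left]; split; lra.
  transitivity (t * f + (1 - t) * f' - y0 * (x2 * x3) -
    b2 * b3 * (t * z1 + (1 - t) * z1') + y0 * b2 * b3); first by ring.
  by rewrite -fE -z1E wE; ring.
(* Subtracting the two pairs of equations leaves D (z1 - z1') = 0. *)
have z1z : z1 = z1' by apply: (mulIf DN0); lra.
by rewrite z1z in e1 *; congr (_, _, _, _); lra.
Qed.

(** Sixteen corners give the twelve listed points: over (a2, a3) the point depends on y0 only, over
    (b2, b3) on y1 only. Over the two mixed corners, y0 = y1 gives hull vertices and y0 different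
    from y1 gives the four additional points. *)
Lemma extreme_points_double_mccormick :
  extreme_points dmc =
    [set v1 b1 a2 a3; v2 a1 a2 a3; v3 a1 a2 b3; v4 a1 b2 a3; v5 a1 b2 b3;
         v6 b1 b2 b3; v7 b1 b2 a3; v8 b1 a2 b3] `|`
    [set v9 a1 b1 a2 b2 a3 b3; v10 a1 b1 a2 b2 a3 b3;
         v11 a1 b1 a2 b2 a3 b3; v12 a1 b1 a2 b2 a3 b3].
Proof.
have DN0 : D != 0 by rewrite gt_eqF.
have q00 y0 y1 : dmc_point a2 a3 y0 y1 = (y0 * a2 * a3, y0, a2, a3).
  by rewrite /dmc_point; congr (_, _, _, _); field.
have q11 y0 y1 : dmc_point b2 b3 y0 y1 = (y1 * b2 * b3, y1, b2, b3).
  by rewrite /dmc_point; congr (_, _, _, _); field.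
have q01 y : dmc_point a2 b3 y y = (y * a2 * b3, y, a2, b3).
  by rewrite /dmc_point; congr (_, _, _, _); field.
have q10 y : dmc_point b2 a3 y y = (y * b2 * a3, y, b2, a3).
  by rewrite /dmc_point; congr (_, _, _, _); field.
have q9 : dmc_point a2 b3 a1 b1 = v9 a1 b1 a2 b2 a3 b3.
  by rewrite /dmc_point /v9 /theta1 /theta2; congr (_, _, _, _); field.
have q10' : dmc_point b2 a3 a1 b1 = v10 a1 b1 a2 b2 a3 b3.
  by rewrite /dmc_point /v10 /theta3 /theta4; congr (_, _, _, _); field.
have q11' : dmc_point b2 a3 b1 a1 = v11 a1 b1 a2 b2 a3 b3.
  by rewrite /dmc_point /v11 /theta5 /theta6; congr (_, _, _, _); field.
have q12 : dmc_point a2 b3 b1 a1 = v12 a1 b1 a2 b2 a3 b3.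
  by rewrite /dmc_point /v12 /theta7 /theta8; congr (_, _, _, _); field.
apply/seteqP; split=> p.
  move=> /extreme_dmc_corner[x2 [x3 [y0 [y1 [[+ + + +]]]]]].
  by move=> [] -> [] -> [] -> [] ->;
    rewrite ?q00 ?q11 ?q01 ?q10 ?q9 ?q10' ?q11' ?q12 => ->; rewrite /=; tauto.
move=> [[[[[[[[]|]|]|]|]|]|]|[[[]|]|]] ->.
- by rewrite /v1 -(q00 _ a1); apply: dmc_corner_extreme; split; auto.
- by rewrite /v2 -(q00 _ a1); apply: dmc_corner_extreme; split; auto.
- by rewrite /v3 -q01; apply: dmc_corner_extreme; split; auto.
- by rewrite /v4 -q10; apply: dmc_corner_extreme; split; auto.
- by rewrite /v5 -(q11 a1); apply: dmc_corner_extreme; split; auto.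
- by rewrite /v6 -(q11 a1); apply: dmc_corner_extreme; split; auto.
- by rewrite /v7 -q10; apply: dmc_corner_extreme; split; auto.
- by rewrite /v8 -q01; apply: dmc_corner_extreme; split; auto.
- by rewrite -q9; apply: dmc_corner_extreme; split; auto.
- by rewrite -q10'; apply: dmc_corner_extreme; split; auto.
- by rewrite -q11'; apply: dmc_corner_extreme; split; auto.
- by rewrite -q12; apply: dmc_corner_extreme; split; auto.
Qed.

End DoubleMcCormickExtreme.

(** * Extreme points and volume difference combined *)

Unset Implicit Arguments.

Theorem theorem4p2 (R : realType) (a1 b1 a2 b2 a3 b3 : R)
    (ha1 : 0 <= a1) (hab1 : a1 < b1)
    (ha2 : 0 <= a2) (hab2 : a2 < b2)
    (ha3 : 0 <= a3) (hab3 : a3 < b3)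
    (hle1 : a1 * b2 * b3 + b1 * a2 * a3 <= b1 * a2 * b3 + a1 * b2 * a3)
    (hle2 : b1 * a2 * b3 + a1 * b2 * a3 <= b1 * b2 * a3 + a1 * a2 * b3) :
  extreme_points (double_mccormick a1 b1 a2 b2 a3 b3) =
    [set v1 b1 a2 a3; v2 a1 a2 a3; v3 a1 a2 b3; v4 a1 b2 a3; v5 a1 b2 b3;
         v6 b1 b2 b3; v7 b1 b2 a3; v8 b1 a2 b3] `|`
    [set v9 a1 b1 a2 b2 a3 b3; v10 a1 b1 a2 b2 a3 b3;
         v11 a1 b1 a2 b2 a3 b3; v12 a1 b1 a2 b2 a3 b3]
  /\
  vol4 (double_mccormick a1 b1 a2 b2 a3 b3) =
    (vol4 (trilinear_hull a1 b1 a2 b2 a3 b3) +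
     ((b1 - a1) * (b2 - a2) ^+ 2 * (b3 - a3) ^+ 2 *
       ((3 * (b1 * b2 * a3 - a1 * b2 * a3 + b1 * a2 * b3 - a1 * a2 * b3)
         + 2 * (a1 * b2 * b3 - b1 * a2 * a3))
        / (24 * (b2 * b3 - a2 * a3))))%:E)%E.
Proof.
split; first exact: extreme_points_double_mccormick.
(* Expanded, this is the first ordering hypothesis; the next inequality is the chain of both. *)
have A12 : a1 * (b2 - a2) * (b3 - a3) <= a2 * (b1 - a1) * (b3 - a3).
  by lra.
have A13 : a1 * (b2 - a2) * (b3 - a3) <= a3 * (b1 - a1) * (b2 - a2).
  by lra.
have D_gt0 : 0 < b2 * b3 - a2 * a3.
  rewrite subr_gt0; apply: (@le_lt_trans _ _ (a2 * b3)).
    by rewrite ler_wpM2l// ltW.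
  by rewrite ltr_pM2r// (le_lt_trans ha3).
rewrite vol4_double_mccormick// vol4_trilinear_hull// -EFinD.
by congr (_%:E); field; rewrite gt_eqF.
Qed.
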